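(* Let $\mathbb{K}$ be an algebraically closed field of characteristic zero, and let $\mathcal{B}_1,\dots,\mathcal{B}_r$ be connected, finite-dimensional, evenly-graded commutative $\mathbb{K}$-algebras such that, for every $j$, $\mathrm{Der}^{<0}(\mathcal{B}_j)=0$ and $\dim_{\mathbb{K}}\mathrm{Der}^0(\mathcal{B}_j)=1$. Then the morphism of algebraic groups $$\rho\colon(\mathbb{K}^* )^r\longrightarrow\mathrm{Aut}^1\Big(\bigotimes_{j=1}^r\mathcal{B}_j\Big),\qquad \rho(t_1,\dots,t_r)=\bigotimes_{j=1}^r\rho_j(t_j),$$ where $\rho_j(t_j)$ is the automorphism of $\mathcal{B}_j$ acting on $\mathcal{B}_j^q$ as $t_j^q\cdot\mathrm{id}$ for all $q$, is onto, with finite kernel. In particular, $\mathrm{Aut}^1(\bigotimes_{j=1}^r\mathcal{B}_j)$ is an $r$-torus.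
   Context: A graded algebra $\mathcal{B}=\bigoplus_{q\ge0}\mathcal{B}^q$ is connected if $\mathcal{B}^0=\mathbb{K}$, and evenly-graded if it is concentrated in even degrees. $\mathrm{Der}^p(\mathcal{B})$ is the space of $\mathbb{K}$-linear maps $\theta\colon\mathcal{B}^*\to\mathcal{B}^{*+p}$ with $\theta(ab)=\theta(a)b+a\theta(b)$ for all $a,b\in\mathcal{B}$; $\mathrm{Der}^{<0}=\bigoplus_{p<0}\mathrm{Der}^p$. Tensor products are over $\mathbb{K}$ and carry the total grading. $\mathrm{Aut}^1(\mathcal{B})$ denotes the connected component of the identity in the linear algebraic group of graded $\mathbb{K}$-algebra automorphisms of $\mathcal{B}$. An $r$-torus is an algebraic group isomorphic to $(\mathbb{K}^* )^r$. *)

(* Defs.v *)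
From HB Require Import structures.
From mathcomp Require Import all_boot all_algebra falgebra.
From mathcomp Require Import all_classical topology.
From mathcomp Require Import mpoly.

Set Implicit Arguments.
Unset Strict Implicit.
Unset Printing Implicit Defensive.

Import GRing.Theory.
Local Open Scope classical_set_scope.
Local Open Scope ring_scope.

#[short(type="comFalgType")]
HB.structure Definition ComFalgebra (K : fieldType) :=
  { A of Falgebra K A & GRing.ComAlgebra K A }.

Section Multilinear.
Variables (K : fieldType) (I : finType) (B : I -> vectType K).

Definition multilinear (W : vectType K) (f : (forall j, B j) -> W) :=
  forall j (b : forall j, B j), linear (fun x : B j => f (dfwith b j x)).

Definition tensor_idx := fprod (fun j => 'I_(\dim {:B j})).

Definition basis_family (u : tensor_idx) : forall j, B j :=
  fun j => (vbasis {:B j})`_(u j).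

Definition coord_prod (u : tensor_idx) (b : forall j, B j) : K :=
  \prod_j coord (vbasis {:B j}) (u j) (b j).

Lemma coord_prod_basis u v : coord_prod u (basis_family v) = (u == v)%:R.
Proof.
rewrite /coord_prod /basis_family.
under eq_bigr => j _ do rewrite coord_free ?(basis_free (vbasisP _)) //.
case: eqP => [->|ne].
  by rewrite big1 // => j _; rewrite eqxx.
have [j nej] : exists j, u j != v j.
  apply/existsP; apply: contra_notT ne => /existsPn h.
  by apply/fprodP => j; apply/eqP; have := h j; rewrite negbK.
by rewrite (bigD1 j) //= eq_sym (negPf nej) mul0r.
Qed.

Lemma coord_prod_multilinear u : @multilinear K^o (coord_prod u).
Proof.
move=> j b a x y.
have E z : coord_prod u (dfwith b j z) = coord (vbasis {:B j}) (u j) z *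
           \prod_(i | i != j) coord (vbasis {:B i}) (u i) (b i).
  rewrite /coord_prod (bigD1 j) //= dfwithin; congr (_ * _).
  by apply: eq_bigr => i ij; rewrite dfwithout // eq_sym.
by rewrite !E linearP mulrDl /GRing.scale /= mulrA.
Qed.

Lemma multilinear_span (W : vectType K) (V : {vspace W})
    (h : (forall j, B j) -> W) (X : forall j, seq (B j)) :
  multilinear h -> (forall b, (forall j, b j \in X j) -> h b \in V) ->
  forall b, (forall j, b j \in <<X j>>%VS) -> h b \in V.
Proof.
move=> hlin hV b bX.
suff H (s : seq I) : forall b, (forall j, b j \in <<X j>>%VS) ->
    (forall j, j \notin s -> b j \in X j) -> h b \in V.
  by apply: (H (enum I)) => // j; rewrite mem_enum.
elim: s => [|j s IH] {bX}b bX hb; first by apply: hV => j; apply: hb.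
pose hj := fun x : B j => h (dfwith b j x).
have hjl : linear hj by apply: hlin.
pose M := GRing.isLinear.Build _ _ _ _ hj hjl.
pose hL : {linear B j -> W} := HB.pack hj M.
have bE : b = dfwith b j (b j).
  by apply: functional_extensionality_dep => i; case: dfwithP.
have bj := bX j; rewrite -[X j]in_tupleE in bj.
rewrite bE -/(hj (b j)) -[hj]/(hL : _ -> _) (coord_span bj) linear_sum.
apply: memv_suml => i _; rewrite linearZ /= memvZ // /hj IH // => k.
  by case: dfwithP => [|k' _] //; rewrite memv_span ?mem_nth.
case: dfwithP => [|k' jk'] ks; first by rewrite mem_nth.
by apply: hb; rewrite inE negb_or eq_sym jk'.
Qed.

Lemma multilinear_eq0 (W : vectType K) (h : (forall j, B j) -> W) :
  multilinear h -> (forall u, h (basis_family u) = 0) -> forall b, h b = 0.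
Proof.
move=> hlin h0 b; apply/eqP; rewrite -memv0.
apply: (multilinear_span (X := fun j => vbasis {:B j})) => // [{}b hb|j].
  have {}hb j : {i : 'I_(\dim {:B j}) | b j = (vbasis {:B j})`_i}.
    by apply: cid; have /tnthP[i ->] := hb j; exists i; rewrite (tnth_nth 0).
  rewrite memv0 -(h0 [fprod j => sval (hb j)]); apply/eqP; congr h.
  by apply: functional_extensionality_dep => j;
    rewrite /basis_family fprodE; case: (hb j).
by rewrite (span_basis (vbasisP _)) memvf.
Qed.

Lemma multilinear_expand (W : vectType K) (f : (forall j, B j) -> W) :
  multilinear f ->
  forall b, f b = \sum_u coord_prod u b *: f (basis_family u).
Proof.
move=> fl b; apply/eqP; rewrite -subr_eq0; apply/eqP; move: b.
apply: multilinear_eq0 => [j b a x y|u].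
  rewrite fl scalerBr addrACA -opprD scaler_sumr -big_split /=.
  congr (_ - _); apply: eq_bigr => u _.
  by rewrite coord_prod_multilinear scalerDl scalerA.
rewrite (bigD1 u) //= coord_prod_basis eqxx scale1r big1 ?addr0 ?subrr //.
by move=> v /negPf vu; rewrite coord_prod_basis vu scale0r.
Qed.

Lemma prod_sum_idx (F : forall j, 'I_(\dim {:B j}) -> K) :
  \prod_j \sum_i F j i = \sum_(u : tensor_idx) \prod_j F j (u j).
Proof.
pose T_ j : finType := 'I_(\dim {:B j}).
pose G j : {ffun T_ j -> K} := finfun (F j).
transitivity (\prod_j \sum_i G j i).
  by apply: eq_bigr => j _; apply: eq_bigr => i _; rewrite ffunE.
transitivity (\sum_(u : fprod T_) \prod_j G j (u j)); last first.
  by apply: eq_bigr => u _; apply: eq_bigr => j _; rewrite ffunE.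
rewrite (@big_fprod K 0 1 *%R +%R I T_ G).
under eq_bigr => j _ do rewrite (big_tag (fun j => G j) j).
rewrite (bigA_distr_big_dep (fun j => mem (tagged_with T_ j))).
by apply: eq_bigl.
Qed.

End Multilinear.

(* The tensor product is realised by coordinates with respect to the products
   of elements of the bases [vbasis]; [tensor_universal] below is its
   universal property.  Its multiplication has no Koszul signs: it is meant for
   evenly graded factors, where these signs are trivial. *)
Definition tensor (K : fieldType) (I : finType) (B : I -> comFalgType K) : Type
  := {ffun tensor_idx B -> K^o}.

HB.instance Definition _ (K : fieldType) (I : finType) (B : I -> comFalgType K)
  := Vector.copy (tensor B) {ffun tensor_idx B -> K^o}.

Section Tensor.
Variables (K : fieldType) (I : finType) (B : I -> comFalgType K).
Local Notation T := (tensor B).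
Local Notation e := (@basis_family K I B).

Definition pure (b : forall j, B j) : T := [ffun u => coord_prod u b].

Lemma pure_multilinear : multilinear pure.
Proof.
move=> j b a x y; apply/ffunP => u.
by rewrite !ffunE coord_prod_multilinear.
Qed.

Lemma tensor_expand (x : T) : x = \sum_u x u *: pure (e u).
Proof.
apply/ffunP => v; rewrite sum_ffunE (bigD1 v) //= !ffunE coord_prod_basis eqxx.
rewrite [_ *: _]mulr1 big1 ?addr0 // => u /negPf uv.
by rewrite !ffunE coord_prod_basis eq_sym uv [_ *: _]mulr0.
Qed.

(* The linear map that the universal property attaches to [f]. *)
Definition tensor_lift (W : vectType K) (f : (forall j, B j) -> W) (x : T) : W
  := \sum_u x u *: f (e u).

Lemma tensor_lift_linear W f : linear (@tensor_lift W f).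
Proof.
move=> a x y; rewrite /tensor_lift scaler_sumr -big_split /=.
by apply: eq_bigr => u _; rewrite !ffunE scalerDl scalerA.
Qed.

HB.instance Definition _ (W : vectType K) (f : (forall j, B j) -> W) :=
  GRing.isLinear.Build K T W _ (@tensor_lift W f) (@tensor_lift_linear W f).

Lemma tensor_lift_pure (W : vectType K) (f : (forall j, B j) -> W) b :
  multilinear f -> tensor_lift f (pure b) = f b.
Proof.
move=> fl; rewrite [RHS]multilinear_expand //.
by apply: eq_bigr => u _; rewrite ffunE.
Qed.

Lemma tensor_ext (W : vectType K) (f g : {linear T -> W}) :
  (forall b, f (pure b) = g (pure b)) -> f =1 g.
Proof.
move=> fg x; rewrite (tensor_expand x) !linear_sum.
by apply: eq_bigr => u _; rewrite !linearZ /= fg.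
Qed.

Theorem tensor_universal (W : vectType K) (f : (forall j, B j) -> W) :
  multilinear f ->
  exists! g : 'Hom(T, W), forall b, g (pure b) = f b.
Proof.
move=> fl; exists (linfun (tensor_lift f)); split=> [b|g hg].
  by rewrite lfunE /= tensor_lift_pure.
by apply/lfunP; apply: tensor_ext => b /=; rewrite lfunE hg /= tensor_lift_pure.
Qed.

Definition tensor_one : T := pure (fun=> 1).

Definition tensor_mul (x y : T) : T :=
  \sum_u \sum_v (x u * y v) *: pure (fun j => e u j * e v j).

Lemma tensor_mul_linl y : linear (tensor_mul^~ y).
Proof.
move=> a x x'; rewrite /tensor_mul scaler_sumr -big_split /=.
apply: eq_bigr => u _; rewrite scaler_sumr -big_split /=.
by apply: eq_bigr => v _; rewrite !ffunE mulrDl scalerDl scalerA mulrA.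
Qed.

Lemma tensor_mul_linr x : linear (tensor_mul x).
Proof.
move=> a y y'; rewrite /tensor_mul scaler_sumr -big_split /=.
apply: eq_bigr => u _; rewrite scaler_sumr -big_split /=.
by apply: eq_bigr => v _; rewrite !ffunE mulrDr scalerDl scalerA mulrCA.
Qed.

HB.instance Definition _ x :=
  GRing.isLinear.Build K T T _ (tensor_mul x) (tensor_mul_linr x).

Lemma tensor_mul_pure a b :
  tensor_mul (pure a) (pure b) = pure (fun j => a j * b j).
Proof.
apply/ffunP => w; rewrite ffunE sum_ffunE.
pose c j i k := coord (vbasis {:B j}) (w j) ((vbasis {:B j})`_i * (vbasis {:B j})`_k).
pose F j i k := coord (vbasis {:B j}) i (a j) * coord (vbasis {:B j}) k (b j) * c j i k.
transitivity (\prod_j \sum_i \sum_k F j i k); last first.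
  apply: eq_bigr => j _.
  rewrite [in RHS](coord_vbasis (memvf (a j))) [in RHS](coord_vbasis (memvf (b j))).
  rewrite mulr_suml linear_sum; apply: eq_bigr => i _.
  rewrite mulr_sumr linear_sum; apply: eq_bigr => k _.
  by rewrite -scalerAl -scalerAr scalerA linearZ.
rewrite prod_sum_idx; apply: eq_bigr => u _.
rewrite prod_sum_idx sum_ffunE; apply: eq_bigr => v _.
by rewrite !ffunE /coord_prod /F /c !big_split.
Qed.

Lemma tensor_mulA : associative tensor_mul.
Proof.
have ext (f g : T -> T) : linear f -> linear g ->
    (forall b, f (pure b) = g (pure b)) -> f =1 g.
  move=> fl gl; pose Mf := GRing.isLinear.Build _ _ _ _ f fl.
  pose Mg := GRing.isLinear.Build _ _ _ _ g gl.
  pose fL : {linear T -> T} := HB.pack f Mf.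
  pose gL : {linear T -> T} := HB.pack g Mg.
  exact: (@tensor_ext T fL gL).
move=> x y z; move: x.
apply: (ext _ _) => [||a].
- by move=> k x y' /=; rewrite tensor_mul_linl.
- by move=> k x y' /=; rewrite !tensor_mul_linl.
move: y; apply: (ext _ _) => [||b].
- by move=> k x y' /=; rewrite tensor_mul_linl tensor_mul_linr.
- by move=> k x y' /=; rewrite tensor_mul_linr tensor_mul_linl.
move: z; apply: (ext _ _) => [||c].
- by move=> k x y' /=; rewrite !tensor_mul_linr.
- by move=> k x y' /=; rewrite !tensor_mul_linr.
rewrite !tensor_mul_pure; congr pure.
by apply: functional_extensionality_dep => j; rewrite mulrA.
Qed.

Lemma tensor_mulC : commutative tensor_mul.
Proof.
move=> x y; rewrite /tensor_mul exchange_big /=.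
apply: eq_bigr => v _; apply: eq_bigr => u _; rewrite mulrC.
by congr (_ *: pure _); apply: functional_extensionality_dep => j; rewrite mulrC.
Qed.

Lemma tensor_mul1 : left_id tensor_one tensor_mul.
Proof.
move=> x; rewrite [x in LHS]tensor_expand linear_sum [RHS]tensor_expand.
apply: eq_bigr => u _; rewrite linearZ /= tensor_mul_pure; congr (_ *: pure _).
by apply: functional_extensionality_dep => j; rewrite mul1r.
Qed.

Lemma tensor_mulDl : left_distributive tensor_mul +%R.
Proof. by by move=> x y z; rewrite ![tensor_mul _ z]tensor_mulC linearD. Qed.

Lemma tensor_one_neq0 : tensor_one != 0.
Proof.
have i j : {i | coord (vbasis {:B j}) i 1 != 0}.
  apply: cid; apply: contrapT => h; have /eqP[] := oner_neq0 (B j).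
  rewrite (coord_vbasis (memvf 1)) big1 // => i _.
  by apply/eqP; rewrite scaler_eq0; apply/orP; left; apply: contra_notT h => ?; exists i.
apply/eqP => /ffunP/(_ [fprod j => sval (i j)]); rewrite !ffunE.
apply/eqP/prodf_neq0 => j _; rewrite fprodE; exact: (svalP (i j)).
Qed.

HB.instance Definition _ := GRing.Zmodule_isComNzRing.Build T
  tensor_mulA tensor_mulC tensor_mul1 tensor_mulDl tensor_one_neq0.

Lemma tensor_scaleAl (a : K) (x y : T) : a *: (x * y) = (a *: x) * y.
Proof. by rewrite ![_ * y]tensor_mulC linearZ. Qed.

HB.instance Definition _ := GRing.Lmodule_isLalgebra.Build K T tensor_scaleAl.
HB.instance Definition _ := GRing.Lalgebra_isComAlgebra.Build K T.
HB.instance Definition _ := Algebra_isFalgebra.Build K T.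

Lemma pureM a b : pure a * pure b = pure (fun j => a j * b j).
Proof. exact: tensor_mul_pure. Qed.

Lemma pure1 : pure (fun=> 1) = 1. Proof. by []. Qed.

Definition tensor_map (f : forall j, 'End(B j)) : 'End(T) :=
  linfun (tensor_lift (fun b => pure (fun j => f j (b j)))).

Lemma tensor_map_pure f b : tensor_map f (pure b) = pure (fun j => f j (b j)).
Proof.
rewrite lfunE /= tensor_lift_pure // => j b' a x y.
have E z : (fun i => f i (dfwith b' j z i)) =
           dfwith (fun i => f i (b' i)) j (f j z).
  apply: functional_extensionality_dep => i.
  by case: dfwithP => [|i' ji']; rewrite ?dfwithin ?dfwithout.
by rewrite !E linearP pure_multilinear.
Qed.

Definition tensor_sub (U : forall j, {vspace B j}) : {vspace T} :=
  <<[seq pure (fun j => (vbasis (U j))`_(u j))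
      | u : fprod (fun j => 'I_(\dim (U j)))]>>%VS.

Lemma tensor_subP (U : forall j, {vspace B j}) (V : {vspace T}) :
  reflect (forall b, (forall j, b j \in U j) -> pure b \in V)
          (tensor_sub U <= V)%VS.
Proof.
apply: (iffP span_subvP) => [UV b bU|UV _ /fintype.imageP[u _ ->]]; last first.
  by apply: UV => j; rewrite vbasis_mem ?mem_nth ?size_tuple.
apply: (multilinear_span (X := fun j => vbasis (U j))) => [|{}b {}bU|j].
- exact: pure_multilinear.
- have {}bU j : {i : 'I_(\dim (U j)) | b j = (vbasis (U j))`_i}.
    by apply: cid; have /tnthP[i ->] := bU j; exists i; rewrite (tnth_nth 0).
  apply: UV; apply/fintype.imageP; exists [fprod j => sval (bU j)] => //; congr pure.
  by apply: functional_extensionality_dep => j; rewrite fprodE; case: (bU j).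
- by rewrite (span_basis (vbasisP _)).
Qed.

Lemma memv_tensor_sub (U : forall j, {vspace B j}) b :
  (forall j, b j \in U j) -> pure b \in tensor_sub U.
Proof. by move=> bU; have /tensor_subP := subvv (tensor_sub U); apply. Qed.

End Tensor.

Record grading (K : fieldType) (A : falgType K) := Grading {
  gr_part :> nat -> {vspace A};
  gr_direct : forall n, directv (\sum_(q < n) gr_part q);
  gr_exhaust : exists n, (\sum_(q < n) gr_part q == fullv)%VS;
  gr_one : 1 \in gr_part 0%N;
  gr_mul : forall p q, (gr_part p * gr_part q <= gr_part (p + q)%N)%VS }.

Section GradedAlgebra.
Variables (K : fieldType) (A : falgType K) (gr : grading A).

(* [1%VS] is the line spanned by the unit. *)
Definition gr_connected : Prop := gr 0%N = 1%VS.

Definition gr_even : Prop := forall q, odd q -> gr q = 0%VS.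

Definition gr_int (m : int) : {vspace A} :=
  if m is Posz q then gr q else 0%VS.

(* K-linearity is part of the type 'End(A). *)
Definition Der (p : int) : set 'End(A) :=
  [set theta | (forall q x, x \in gr q -> theta x \in gr_int (q%:Z + p)) /\
               (forall a b, theta (a * b) = theta a * b + a * theta b)].

Definition gr_aut : set 'End(A) :=
  [set g | [/\ lker g == 0%VS, g 1 = 1, forall a b, g (a * b) = g a * g b
             & forall q, (g @: gr q <= gr q)%VS]].

Definition gr_bound : nat := ex_minn (gr_exhaust gr).

Definition gr_proj (q : nat) : 'End(A) :=
  \sum_(i < gr_bound | i == q :> nat) sumv_pi (\sum_(i < gr_bound) gr i)%VS i.

(* Multiplication by [t ^+ q] on the part of degree [q], see [gr_scaleE]. *)
Definition gr_scale (t : K) : 'End(A) :=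
  \sum_(q < gr_bound) t ^+ q *: gr_proj q.

Lemma gr_boundE : (\sum_(q < gr_bound) gr q)%VS = fullv.
Proof. by rewrite /gr_bound; case: ex_minnP => n /eqP. Qed.

Lemma gr_eq0 q : (gr_bound <= q)%N -> gr q = 0%VS.
Proof.
move=> le_q; apply/eqP; rewrite -dimv_eq0.
have full : (\sum_(i < q) gr i)%VS = fullv.
  apply/eqP; rewrite eqEsubv subvf -gr_boundE.
  apply/subv_sumP => i _.
  exact: (sumv_sup (widen_ord le_q i)).
have := gr_direct gr q.+1; have := gr_direct gr q.
rewrite !directvE /= !big_ord_recr /= full => /eqP <-.
have -> : (fullv + gr q)%VS = fullv by apply/addv_idPl; exact: subvf.
by rewrite -[X in X == _]addn0 eqn_add2l eq_sym.
Qed.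

Lemma gr_projE p q x : x \in gr p -> gr_proj q x = if p == q then x else 0.
Proof.
move=> xp; have [lt_p|le_p] := ltnP p gr_bound; last first.
  by move: xp; rewrite gr_eq0 // memv0 => /eqP ->; rewrite linear0 if_same.
pose p' := Ordinal lt_p.
pose P i := sumv_pi (\sum_(i < gr_bound) gr i)%VS i.
have PE i : P i x = if i == p' then x else 0.
  have /directv_sum_unique/(_ (fun i => P i x)
    (fun i => if i == p' then x else 0)) := gr_direct gr gr_bound.
  rewrite (sumv_pi_sum (erefl _)) ?gr_boundE ?memvf // -big_mkcond big_pred1_eq.
  rewrite eqxx => H; apply/eqP; apply: (forallP (esym (H _ _)) i) => // {}i _.
    exact: memv_sum_pi.
  by case: eqP => [->|_] //; rewrite mem0v.
rewrite sum_lfunE.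
under eq_bigr => i _ do rewrite -/(P i) PE.
have [<-|npq] := eqVneq p q.
  rewrite (bigD1 p') //= eqxx big1 ?addr0 // => i /andP[_ /negPf ->] //.
by rewrite big1 // => i /eqP iq; case: eqP => // ip; rewrite -iq ip eqxx in npq.
Qed.

Lemma gr_proj_mem q x : gr_proj q x \in gr q.
Proof.
rewrite sum_lfunE; apply: memv_suml => i /eqP <-; exact: memv_sum_pi.
Qed.

Lemma gr_proj_sum x : x = \sum_(q < gr_bound) gr_proj q x.
Proof.
have xs : x \in (\sum_(i < gr_bound) gr i)%VS by rewrite gr_boundE memvf.
rewrite -[LHS](sumv_pi_sum (erefl (\sum_(i < gr_bound) gr i)%VS) xs).
apply: eq_bigr => i _; rewrite sum_lfunE; symmetry.
by apply: (big_pred1 i) => k; rewrite /= val_eqE.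
Qed.

Lemma gr_scaleE t q x : x \in gr q -> gr_scale t x = t ^+ q *: x.
Proof.
move=> xq; rewrite sum_lfunE.
under eq_bigr => i _ do rewrite scale_lfunE (gr_projE _ xq).
have [lt_q|le_q] := ltnP q gr_bound; last first.
  move: xq; rewrite gr_eq0 // memv0 => /eqP ->; rewrite scaler0 big1 // => i _.
  by rewrite if_same scaler0.
rewrite (bigD1 (Ordinal lt_q)) //= eqxx big1 ?addr0 // => i iq.
by rewrite ifN ?scaler0 // eq_sym; apply: contra_neq iq => ?; apply: val_inj.
Qed.

End GradedAlgebra.

Section TensorGrading.
Variables (K : fieldType) (I : finType) (B : I -> comFalgType K).
Variable gr : forall j, grading (B j).

Definition tensor_part (q : nat) : {vspace tensor B} :=
  (\sum_(d : {ffun I -> 'I_q.+1} | (\sum_j d j)%N == q)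
      tensor_sub (fun j => gr j (d j)))%VS.

Lemma tensor_partP q (V : {vspace tensor B}) :
  reflect (forall (d : I -> nat) b, (\sum_j d j)%N = q ->
             (forall j, b j \in gr j (d j)) -> pure b \in V)
          (tensor_part q <= V)%VS.
Proof.
apply: (iffP subv_sumP) => [H d b dq bd|H d /eqP dq]; last first.
  by apply/tensor_subP => b bd; exact: (H (fun j => d j : nat) b dq bd).
have lt_d j : (d j < q.+1)%N by rewrite ltnS -dq (bigD1 j) //= leq_addr.
pose d' := [ffun j => Ordinal (lt_d j)].
have := H d'; rewrite (eq_bigr d) => [|j _]; last by rewrite ffunE.
move=> /(_ (introT eqP dq))/tensor_subP; apply => j; rewrite ffunE; exact: bd.
Qed.

Lemma pure_tensor_part (d : I -> nat) b :
  (forall j, b j \in gr j (d j)) -> pure b \in tensor_part (\sum_j d j).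
Proof.
by move=> bd; have /tensor_partP := subvv (tensor_part (\sum_j d j)); apply.
Qed.

(* The abstraction over [P] prevents [directv] from unfolding [tensor_part] and
   asserting the directness of the inner sums as well. *)
Lemma tensor_part_direct n :
  (fun P : nat -> {vspace tensor B} => directv (\sum_(q < n) P q)) tensor_part.
Proof.
pose E q : 'End(tensor B) := \sum_(d : {ffun I -> 'I_q.+1} | (\sum_j d j)%N == q)
  tensor_map (fun j => gr_proj (gr j) (d j)).
have EE p q x : x \in tensor_part p -> E q x = if p == q then x else 0.
  move=> xp.
  pose F : 'End(tensor B) := E q - (if p == q then \1%VF else 0).
  suff : (tensor_part p <= lker F)%VS.
    move=> /subvP/(_ x xp).
    rewrite memv_ker add_lfunE opp_lfunE subr_eq0 => /eqP ->.
    by case: eqP => _; rewrite ?id_lfunE ?zero_lfunE.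
  apply/tensor_partP => d b dp bd.
  rewrite memv_ker add_lfunE opp_lfunE subr_eq0 sum_lfunE; apply/eqP.
  under eq_bigr => d' _.
    rewrite tensor_map_pure.
    have -> : pure (fun j => gr_proj (gr j) (d' j) (b j)) =
              if [forall j, d j == d' j] then pure b else 0.
      case: ifPn => [/forallP h|/forallPn[j jd]].
        congr pure; apply: functional_extensionality_dep => j.
        by rewrite (gr_projE _ (bd j)) h.
      have -> : (fun j => gr_proj (gr j) (d' j) (b j)) =
          dfwith (fun j => gr_proj (gr j) (d' j) (b j)) j 0.
        apply: functional_extensionality_dep => i; case: dfwithP => //.
        by rewrite (gr_projE _ (bd j)) (negPf jd).
      have := @pure_multilinear K I B j
        (fun j => gr_proj (gr j) (d' j) (b j)) (-1) 0 0.
      by rewrite scaler0 addr0 scaleN1r addNr.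
    over.
  case: eqP => [pq|npq]; rewrite ?id_lfunE ?zero_lfunE; last first.
    rewrite big1 // => d' /eqP d'q; case: ifP => // /forallP h; case: npq.
    by rewrite -dp -d'q; apply: eq_bigr => j _; apply/eqP.
  have lt_d j : (d j < q.+1)%N by rewrite ltnS -pq -dp (bigD1 j) //= leq_addr.
  pose d0 := [ffun j => Ordinal (lt_d j)].
  rewrite (bigD1 d0) /=; last first.
    by apply/eqP; rewrite -[RHS]pq -dp; apply: eq_bigr => j _; rewrite ffunE.
  rewrite ifT; last by apply/forallP => j; rewrite ffunE.
  rewrite big1 ?addr0 // => d' /andP[_ /eqP nd]; case: ifP => // /forallP h.
  by case: nd; apply/ffunP => j; apply/val_inj; rewrite /= ffunE /= (eqP (h j)).
move: tensor_part EE => P EE /=.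
apply/directv_sum_independent => us Uu us0 i _.
have := congr1 (E i) us0; rewrite linear0 linear_sum (bigD1 i) //=.
rewrite (EE i i) ?Uu // eqxx big1 ?addr0 // => k ki.
by rewrite (EE k i) ?Uu // val_eqE (negPf ki).
Qed.

Lemma tensor_part_exhaust : exists n, (\sum_(q < n) tensor_part q == fullv)%VS.
Proof.
pose N := (\sum_j gr_bound (gr j))%N; exists N.+1.
rewrite eqEsubv subvf; apply/subvP => x _.
rewrite [x]tensor_expand; apply: memv_suml => u _; apply: memvZ.
pose X j := [seq gr_proj (gr j) q y | q <- iota 0 (gr_bound (gr j)), y <- vbasis {:B j}].
apply: (multilinear_span (X := X)) => [|b bX|j].
- exact: pure_multilinear.
- have {}bX j : {d : nat | (d < gr_bound (gr j))%N /\ b j \in gr j d}.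
    apply: cid; have /allpairsP[[q y] [/= qb _ ->]] := bX j.
    by exists q; rewrite gr_proj_mem; split=> //; rewrite mem_iota in qb.
  pose d j := sval (bX j).
  have le_d : (\sum_j d j < N.+1)%N.
    rewrite ltnS; apply: leq_sum => j _.
    by rewrite ltnW // /d; case: (bX j) => ? [].
  apply: (subvP (sumv_sup (Ordinal le_d) _ (subvv _))) => //=.
  by apply: pure_tensor_part => j; rewrite /d; case: (bX j) => ? [].
- rewrite [basis_family u j](gr_proj_sum (gr j)); apply: memv_suml => q _.
  apply/memv_span/allpairsP; exists (q : nat, basis_family u j) => /=.
  by rewrite mem_iota /= ltn_ord mem_nth ?size_tuple.
Qed.

Lemma tensor_part_one : 1 \in tensor_part 0.
Proof.
have /tensor_partP H := subvv (tensor_part 0); rewrite -pure1.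
by apply: (H (fun=> 0%N)) => [|j]; [rewrite big1 | apply: gr_one].
Qed.

Lemma tensor_part_mul p q :
  (tensor_part p * tensor_part q <= tensor_part (p + q))%VS.
Proof.
apply/prodvP => x y xp yq.
suff : (tensor_part p <= amulr y @^-1: tensor_part (p + q))%VS.
  by move=> /subvP/(_ x xp); rewrite -memv_preim lfunE.
apply/tensor_partP => d b dp bd; rewrite -memv_preim lfunE /=.
suff : (tensor_part q <= amull (pure b) @^-1: tensor_part (p + q))%VS.
  by move=> /subvP/(_ y yq); rewrite -memv_preim lfunE.
apply/tensor_partP => d' b' dq bd'; rewrite -memv_preim lfunE /= pureM.
rewrite -dp -dq -big_split; apply: pure_tensor_part => j.
exact: (subvP (gr_mul _ _ _)) (memv_mul (bd j) (bd' j)).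
Qed.

Definition tensor_grading : grading (tensor B) :=
  Grading tensor_part_direct tensor_part_exhaust tensor_part_one tensor_part_mul.

End TensorGrading.

Section Zariski.
Variable K : fieldType.
Implicit Type W : vectType K.

(* A vector space is an affine space through its coordinates in [vbasis]; a
   change of basis only changes [p] linearly. *)
Definition polyval W (p : {mpoly K[\dim {:W}]}) (w : W) : K :=
  p.@[fun i => coord (vbasis {:W}) i w].

Definition zariski W : Type := W.

HB.instance Definition _ W := Choice.copy (zariski W) W.

Definition zariski_open W (U : set (zariski W)) : Prop :=
  exists S : set {mpoly K[\dim {:W}]},
    U = [set w | exists2 p, S p & polyval p w != 0].

Lemma zariski_openT W : zariski_open [set: zariski W].
Proof.
exists [set 1]; apply/seteqP; split=> w _ //; exists 1 => //.
by rewrite /polyval meval1 oner_neq0.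
Qed.

Lemma zariski_openI W : setI_closed (@zariski_open W).
Proof.
move=> _ _ [S ->] [S' ->]; exists [set p * p' | p in S & p' in S'].
apply/seteqP; split=> w.
  move=> [[p Sp pw] [p' Sp' pw']]; exists (p * p'); first by exists p => //; exists p'.
  by rewrite /polyval mevalM mulf_neq0.
move=> [_ [p Sp [p' Sp' <-]]]; rewrite /polyval mevalM mulf_eq0 negb_or.
by move=> /andP[pw pw']; split; [exists p|exists p'].
Qed.

Lemma zariski_open_bigU W (I : Type) (f : I -> set (zariski W)) :
  (forall i, zariski_open (f i)) -> zariski_open (\bigcup_i f i).
Proof.
move=> /choice[S fS]; exists (\bigcup_i S i); apply/seteqP; split=> w.
  by move=> [i _]; rewrite fS => -[p Sp pw]; exists p => //; exists i.
by move=> [p [i _ Sp] pw]; exists i => //; rewrite fS; exists p.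
Qed.

HB.instance Definition _ W := isOpenTopological.Build (zariski W)
  (@zariski_openT W) (@zariski_openI W) (@zariski_open_bigU W).

(* Regular functions and maps on quasi-affine sets: [std_torus] is open in K^r,
   and a linear algebraic group is closed in the open set [lin_group W]. *)
Definition regular_fun W (X : set W) (f : W -> K) : Prop :=
  forall x, X x -> exists U : set (zariski W), [/\ open U, U x &
    exists p q, forall y, X y -> U y ->
      polyval q y != 0 /\ f y = polyval p y / polyval q y].

Definition regular_map W W' (X : set W) (Y : set W') (f : W -> W') : Prop :=
  (forall x, X x -> Y (f x)) /\
  (forall i, regular_fun X (fun x => coord (vbasis {:W'}) i (f x))).

Definition lin_group W : set 'End(W) := [set f | lker f == 0%VS].

(* The closed subsets of [lin_group W] are the traces of the closed subsets of
   'End(W), since inverting the determinant does not change zero loci. *)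
Definition lin_alg_group W (G : set 'End(W)) : Prop :=
  [/\ G \1%VF,
      forall f g, G f -> G g -> G (f \o g)%VF,
      forall f, G f -> G (f^-1)%VF
    & exists2 C : set (zariski 'End(W)), closed C & G = C `&` @lin_group W].

Definition std_torus r : set 'rV[K]_r := [set t | forall j, t ord0 j != 0].

Definition std_torus_mul r (s t : 'rV[K]_r) : 'rV[K]_r :=
  \row_j (s ord0 j * t ord0 j).

Definition torus_morphism r W (G : set 'End(W)) (phi : 'rV[K]_r -> 'End(W)) :=
  regular_map (@std_torus r) G phi /\
  (forall s t, std_torus s -> std_torus t ->
     phi (std_torus_mul s t) = (phi s \o phi t)%VF).

Definition is_torus r W (G : set 'End(W)) : Prop :=
  lin_alg_group G /\
  exists (phi : 'rV[K]_r -> 'End(W)) (psi : 'End(W) -> 'rV[K]_r),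
    [/\ torus_morphism G phi, regular_map G (@std_torus r) psi,
        forall t, std_torus t -> psi (phi t) = t
      & forall g, G g -> phi (psi g) = g].

Definition set_dim W (P : set W) (n : nat) : Prop :=
  exists2 U : {vspace W}, P = [set v | v \in U] & \dim U = n.

(* The component is taken for the topology induced on [gr_aut gr] by the Zariski
   topology of 'End(A). *)
Definition gr_aut1 (A : falgType K) (gr : grading A) : set 'End(A) :=
  connected_component (gr_aut gr : set (zariski 'End(A))) \1%VF.

Definition torus_action r (B : 'I_r -> comFalgType K)
    (gr : forall j, grading (B j)) (t : 'rV[K]_r) : 'End(tensor B) :=
  tensor_map (fun j => gr_scale (gr j) (t ord0 j)).

End Zariski.

(* Main.v *)
(** Let [T] be the image of the torus in the group [G] of graded automorphisms
    of the tensor product [A].  It is connected, being covered by punctured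
    affine lines through the identity, so everything rests on [T] being open
    in [G]: an open subgroup is also closed, hence contains the component.

    Contracting a derivation of degree 0 of [A] against homogeneous functionals
    on all factors but [B j] gives derivations of [B j] of degree at most 0, so
    the hypotheses leave only the combinations of the [r] Euler derivations.
    Choose a rational section [g |-> tau g] of the (effective) torus action,
    built from diagonal coefficients of [g] by a Bezout relation between the
    degrees.  For [g] in [G] near 1, [h = g rho(tau g)^-1] lies in the slice
    [tau h = 1] of [G], whose tangent space at 1 consists of the derivations of
    degree 0 on which [d tau] vanishes, and is therefore 0.  A set cut out by
    polynomial equations with zero tangent space at a point has that point as an
    isolated point, so [h = 1] and [g = rho(tau g)] lies in [T]. *)

From HB Require Import structures.
Require Import Defs.
From mathcomp Require Import all_boot all_algebra falgebra.
From mathcomp Require Import all_classical topology.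
From mathcomp Require Import mpoly.

Set Implicit Arguments.
Unset Strict Implicit.
Unset Printing Implicit Defensive.

Import GRing.Theory.
Local Open Scope classical_set_scope.
Local Open Scope ring_scope.

(** * Algebras of functions *)

(** Stated for a predicate so that the same closure lemmas serve polynomial functions on a vector
    space, rational functions on a fixed set and polynomials in one parameter along a curve. *)
Record function_algebra (K : fieldType) (X : Type) (S : set (X -> K)) : Prop :=
  FunctionAlgebra {
    fa_cst : forall c, S (fun=> c);
    fa_add : forall f g, S f -> S g -> S (fun x => f x + g x);
    fa_mul : forall f g, S f -> S g -> S (fun x => f x * g x) }.

Section FunctionAlgebraTheory.
Variables (K : fieldType) (X : Type) (S : set (X -> K)).
Hypothesis SA : function_algebra S.

Lemma fa_sum I (s : seq I) (P : pred I) (F : I -> X -> K) :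
  (forall i, P i -> S (F i)) -> S (fun x => \sum_(i <- s | P i) F i x).
Proof.
move=> FS; elim: s => [|i s IH].
  under eq_fun do rewrite big_nil.
  exact: (fa_cst SA).
under eq_fun do rewrite big_cons.
by case Pi: (P i) => //; apply: (fa_add SA) => //; apply: FS.
Qed.

Lemma fa_prod I (s : seq I) (P : pred I) (F : I -> X -> K) :
  (forall i, P i -> S (F i)) -> S (fun x => \prod_(i <- s | P i) F i x).
Proof.
move=> FS; elim: s => [|i s IH].
  under eq_fun do rewrite big_nil.
  exact: (fa_cst SA).
under eq_fun do rewrite big_cons.
by case Pi: (P i) => //; apply: (fa_mul SA) => //; apply: FS.
Qed.

Lemma fa_exp f n : S f -> S (fun x => f x ^+ n).
Proof.
move=> fS; elim: n => [|n IH].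
  under eq_fun do rewrite expr0.
  exact: (fa_cst SA).
under eq_fun do rewrite exprS.
exact: (fa_mul SA).
Qed.

Lemma fa_scale c f : S f -> S (fun x => c * f x).
Proof. by apply: (fa_mul SA); apply: fa_cst. Qed.

Lemma fa_det n (M : X -> 'M[K]_n) :
  (forall i j, S (fun x => M x i j)) -> S (fun x => \det (M x)).
Proof.
move=> MS; apply: fa_sum => s _; apply: fa_scale.
by apply: fa_prod => i _; apply: MS.
Qed.

Definition fa_map (W : vectType K) (phi : X -> W) : Prop :=
  forall i, S (fun x => coord (vbasis {:W}) i (phi x)).

Lemma fa_polyval (W : vectType K) (p : {mpoly K[\dim {:W}]}) (phi : X -> W) :
  fa_map phi -> S (fun x => polyval p (phi x)).
Proof.
move=> phiS; rewrite /polyval; under eq_fun do rewrite mevalE.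
apply: fa_sum => m _; apply: fa_scale; apply: fa_prod => i _.
exact/fa_exp/phiS.
Qed.

Lemma fa_linear (W : vectType K) (l : {linear W -> K^o}) (phi : X -> W) :
  fa_map phi -> S (fun x => l (phi x)).
Proof.
move=> phiS.
under eq_fun => x.
  rewrite (coord_vbasis (memvf (phi x))) linear_sum /=.
  under eq_bigr => i _ do rewrite linearZ /= [_ *: _]mulrC.
  over.
by apply: fa_sum => i _; apply: fa_scale; apply: phiS.
Qed.

Lemma fa_map_linear (W W' : vectType K) (l : {linear W -> W'}) (phi : X -> W) :
  fa_map phi -> fa_map (fun x => l (phi x)).
Proof. by move=> phiS i; apply: (fa_linear (coord (vbasis {:W'}) i \o l)). Qed.

Lemma fa_map_cst (W : vectType K) (w : W) : fa_map (fun=> w).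
Proof. by move=> i; apply: fa_cst. Qed.

Lemma fa_map_lincomb (W : vectType K) I (s : seq I) (F : I -> X -> K)
    (w : I -> X -> W) :
  (forall i, S (F i)) -> (forall i, fa_map (w i)) ->
  fa_map (fun x => \sum_(i <- s) F i x *: w i x).
Proof.
move=> FS wS k; under eq_fun => x.
  rewrite linear_sum /=.
  under eq_bigr => i _ do rewrite linearZ /=.
  over.
by apply: fa_sum => i _; apply: (fa_mul SA) => //; apply: wS.
Qed.

Lemma fa_map_add (W : vectType K) (phi psi : X -> W) :
  fa_map phi -> fa_map psi -> fa_map (fun x => phi x + psi x).
Proof.
move=> phiS psiS i; under eq_fun do rewrite linearD.
by apply: (fa_add SA); [apply: phiS | apply: psiS].
Qed.

Section LinearMaps.
Variables W W' : vectType K.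

Definition rank_one k (y : W') (x : W) : W' := coord (vbasis {:W}) k x *: y.

Lemma rank_one_linear k y : linear (rank_one k y).
Proof. by move=> a x x'; rewrite /rank_one linearP scalerDl scalerA. Qed.

HB.instance Definition _ k y :=
  GRing.isLinear.Build K W W' _ (rank_one k y) (rank_one_linear k y).

Definition rank_one_hom k (y : W') : 'Hom(W, W') := linfun (rank_one k y).

Lemma rank_one_hom_linear k : linear (rank_one_hom k).
Proof.
move=> a y y'; apply/lfunP => x.
by rewrite add_lfunE scale_lfunE !lfunE /= /rank_one scalerDr !scalerA mulrC.
Qed.

HB.instance Definition _ k := GRing.isLinear.Build K W' 'Hom(W, W') _
  (rank_one_hom k) (rank_one_hom_linear k).

Definition eval_at (v : W) (f : 'Hom(W, W')) : W' := f v.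

Lemma eval_at_linear v : linear (eval_at v).
Proof. by move=> a f g; rewrite /eval_at add_lfunE scale_lfunE. Qed.

HB.instance Definition _ v := GRing.isLinear.Build K 'Hom(W, W') W' _
  (eval_at v) (eval_at_linear v).

(** The basis of ['Hom(W, W')] that defines its coordinates is arbitrary, so the map is rebuilt from
    its values on basis vectors through rank-one maps. *)
Lemma fa_map_lfun (phi : X -> 'Hom(W, W')) :
  (forall v, fa_map (fun x => phi x v)) -> fa_map phi.
Proof.
move=> phiS.
have -> : phi = fun x => \sum_k 1 *: rank_one_hom k (phi x (vbasis {:W})`_k).
  apply/funext => x; apply/lfunP => v.
  rewrite {1}(coord_vbasis (memvf v)) linear_sum sum_lfunE.
  by apply: eq_bigr => k _; rewrite linearZ /= scale1r lfunE.
apply: fa_map_lincomb => k; first exact: fa_cst.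
exact: (fa_map_linear (rank_one_hom k)).
Qed.

Lemma fa_map_app (phi : X -> 'Hom(W, W')) (v : X -> W) :
  fa_map phi -> fa_map v -> fa_map (fun x => phi x (v x)).
Proof.
move=> phiS vS.
under [X in fa_map X]eq_fun => x.
  rewrite (coord_vbasis (memvf (v x))) linear_sum /=.
  under eq_bigr => k _ do rewrite linearZ /=.
  over.
apply: fa_map_lincomb => k; first exact: vS.
exact: (fa_map_linear (eval_at (vbasis {:W})`_k)).
Qed.

End LinearMaps.

Lemma fa_map_comp (W : vectType K) (phi psi : X -> 'End(W)) :
  fa_map phi -> fa_map psi -> fa_map (fun x => (phi x \o psi x)%VF).
Proof.
move=> phiS psiS; apply: fa_map_lfun => v.
under [X in fa_map X]eq_fun do rewrite comp_lfunE.
by apply: fa_map_app => //; apply: fa_map_app => //; apply: fa_map_cst.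
Qed.

End FunctionAlgebraTheory.

(** * Polynomial functions, rational functions and Zariski open sets *)

Section PolynomialFunctions.
Variables (K : fieldType) (W : vectType K).

Definition poly_fun : set (W -> K) :=
  [set f | exists p : {mpoly K[\dim {:W}]}, f = polyval p].

Lemma poly_fun_algebra : function_algebra poly_fun.
Proof.
split=> [c|_ _ [p ->] [q ->]|_ _ [p ->] [q ->]].
- by exists c%:MP; apply/funext => w; rewrite /polyval mevalC.
- by exists (p + q); apply/funext => w; rewrite /polyval mevalD.
- by exists (p * q); apply/funext => w; rewrite /polyval mevalM.
Qed.

Lemma poly_fun_coord i : poly_fun (coord (vbasis {:W}) i).
Proof. by exists 'X_i; apply/funext => w; rewrite /polyval mevalXU. Qed.

Lemma poly_fun_id : fa_map poly_fun (@id W).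
Proof. by move=> i; apply: poly_fun_coord. Qed.

Lemma poly_fun_comp (W' : vectType K) (phi : W -> W') (f : W' -> K) :
  fa_map poly_fun phi -> (exists p, f = polyval p) -> poly_fun (f \o phi).
Proof. by move=> phiP [p ->]; apply: fa_polyval phiP; apply: poly_fun_algebra. Qed.

(** A single fraction valid on all of [X], which is stronger than the local fractions of
    [regular_fun] and is visibly stable under the algebra operations. *)
Definition rat_fun (X : set W) : set (W -> K) :=
  [set f | exists p q, [/\ poly_fun p, poly_fun q &
     forall x, X x -> q x != 0 /\ f x = p x / q x]].

Lemma rat_fun_algebra X : function_algebra (rat_fun X).
Proof.
have PA := poly_fun_algebra.
split=> [c|f g [p [q [pP qP fE]]] [p' [q' [p'P q'P gE]]]
          |f g [p [q [pP qP fE]]] [p' [q' [p'P q'P gE]]]].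
- exists (fun=> c), (fun=> 1); split=> [||x _]; rewrite ?oner_neq0 ?divr1 //;
    exact: (fa_cst PA).
- exists (fun x => p x * q' x + p' x * q x), (fun x => q x * q' x); split=> [||x Xx].
  + by apply: (fa_add PA) => //; apply: (fa_mul PA).
  + exact: (fa_mul PA).
  + have [qx ->] := fE x Xx; have [q'x ->] := gE x Xx.
    by rewrite mulf_neq0 // addf_div.
- exists (fun x => p x * p' x), (fun x => q x * q' x); split=> [||x Xx].
  + exact: (fa_mul PA).
  + exact: (fa_mul PA).
  + have [qx ->] := fE x Xx; have [q'x ->] := gE x Xx.
    by rewrite mulf_neq0 // mulf_div.
Qed.

Lemma rat_fun_poly X f : poly_fun f -> rat_fun X f.
Proof.
move=> fP; exists f, (fun=> 1); split=> // [|x _].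
  exact: fa_cst poly_fun_algebra _.
by rewrite oner_neq0 divr1.
Qed.

Lemma rat_fun_inv (X : set W) f :
  (forall x, X x -> f x != 0) -> rat_fun X f -> rat_fun X (fun x => (f x)^-1).
Proof.
move=> f0 [p [q [pP qP fE]]]; exists q, p; split=> // x Xx.
have [qx fx] := fE x Xx; have := f0 x Xx.
by rewrite fx mulf_eq0 negb_or invf_div => /andP[].
Qed.

Lemma rat_fun_regular X f : rat_fun X f -> regular_fun X f.
Proof.
move=> [_ [_ [[p ->] [q ->] fE]]] x Xx; exists setT; split=> //.
  exact: openT.
by exists p, q => y Xy _; apply: fE.
Qed.

Lemma poly_fun_open (f : W -> K) :
  poly_fun f -> open ([set w | f w != 0] : set (zariski W)).
Proof.
move=> [p ->]; exists [set p]; apply/seteqP; split=> w /=.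
  by exists p.
by move=> [_ ->].
Qed.

Lemma zariski_openP (U : set (zariski W)) (w : W) : open U -> U w ->
  exists f, [/\ poly_fun f, f w != 0 & forall x, f x != 0 -> U x].
Proof.
move=> [S ->] [p Sp pw]; exists (polyval p); split=> //; first by exists p.
by move=> x px; exists p.
Qed.

Lemma zariski_open_preimage (W' : vectType K) (phi : W -> W') (U : set (zariski W')) :
  fa_map poly_fun phi -> open U -> open ([set w | U (phi w)] : set (zariski W)).
Proof.
move=> phiP [S ->].
have /choice[q qE] (p : {mpoly K[\dim {:W'}]}) :
    exists q : {mpoly K[\dim {:W}]}, (fun w => polyval p (phi w)) = polyval q.
  by apply: poly_fun_comp phiP _; exists p.
exists (q @` S); apply/seteqP; split=> w /= [p Sp].
  move=> pw; exists (q p); first by exists p.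
  by rewrite -qE.
by case: Sp => p' Sp' <-; rewrite -qE => pw; exists p'.
Qed.

End PolynomialFunctions.

(** * Isolated points *)

Section IsolatedPoints.
Variables (K : fieldType) (W : vectType K).
Local Notation n := (\dim {:W}).
Local Notation x_ := (coord (vbasis {:W})).
Let PA := poly_fun_algebra W.

(* [f] is a polynomial function with differential [l] at the origin; the
   functions [m i] are not unique, but their values at 0 are. *)
Definition has_diff0 (f : W -> K) (l : 'Hom(W, K^o)) : Prop :=
  exists m : 'I_n -> W -> K,
    [/\ forall i, poly_fun (m i),
        forall w, f w = f 0 + \sum_i m i w * x_ i w
      & forall w, l w = \sum_i m i 0 * x_ i w].

Lemma has_diff0_poly f l : has_diff0 f l -> poly_fun f.
Proof.
move=> [m [mP fE _]]; rewrite (_ : f = fun w => f 0 + \sum_i m i w * x_ i w).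
  apply: fa_add => //; first exact: fa_cst PA _.
  by apply: fa_sum => // i _; apply: fa_mul => //; apply: poly_fun_coord.
exact/funext.
Qed.

Lemma has_diff0_linear c (l : 'Hom(W, K^o)) : has_diff0 (fun w => c + l w) l.
Proof.
exists (fun (i : 'I_n) _ => l (vbasis {:W})`_i).
have lE w : l w = \sum_(i < n) l (vbasis {:W})`_i * x_ i w.
  rewrite [w in LHS](coord_vbasis (memvf w)) linear_sum.
  by apply: eq_bigr => i _; rewrite linearZ mulrC.
split=> // [i|w]; first exact: fa_cst PA _.
by rewrite linear0 addr0 -lE.
Qed.

Lemma has_diff0_cst c : has_diff0 (fun=> c) 0.
Proof.
have := has_diff0_linear c 0.
by under eq_fun do rewrite zero_lfunE addr0.
Qed.

Lemma has_diff0_add f g l l' :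
  has_diff0 f l -> has_diff0 g l' -> has_diff0 (fun w => f w + g w) (l + l').
Proof.
move=> [m [mP fE lE]] [m' [m'P gE l'E]]; exists (fun i w => m i w + m' i w).
split=> [i|w|w]; first exact: (fa_add PA).
  rewrite fE gE addrACA -big_split /=; congr (_ + _).
  by apply: eq_bigr => i _; rewrite mulrDl.
rewrite add_lfunE lE l'E -big_split /=.
by apply: eq_bigr => i _; rewrite mulrDl.
Qed.

Lemma has_diff0_mul f g l l' : has_diff0 f l -> has_diff0 g l' ->
  has_diff0 (fun w => f w * g w) (g 0 *: l + f 0 *: l').
Proof.
move=> [m [mP fE lE]] gd; have gP := has_diff0_poly gd.
case: gd => m' [m'P gE l'E].
exists (fun i w => m i w * g w + f 0 * m' i w).
split=> [i|w|w].
- by apply: (fa_add PA); [apply: (fa_mul PA) | apply: (fa_scale PA)].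
- rewrite [f w]fE mulrDl [g w in X in X + _]gE mulrDr -addrA; congr (_ + _).
  rewrite mulr_sumr mulr_suml -big_split /=.
  by apply: eq_bigr => i _; rewrite mulrDl addrC mulrA mulrAC.
- rewrite add_lfunE !scale_lfunE lE l'E [_ *: _]mulr_sumr [X in _ + X]mulr_sumr.
  rewrite -big_split /=; apply: eq_bigr => i _.
  by rewrite mulrDl mulrA [g 0 * _]mulrC mulrA.
Qed.

Lemma has_diff0_opp f l : has_diff0 f l -> has_diff0 (fun w => - f w) (- l).
Proof.
move=> fd; have := has_diff0_mul (has_diff0_cst (-1)) fd.
rewrite scaler0 add0r scaleN1r.
by under eq_fun do rewrite mulN1r.
Qed.

Lemma has_diff0_sub f g l l' :
  has_diff0 f l -> has_diff0 g l' -> has_diff0 (fun w => f w - g w) (l - l').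
Proof. by move=> fd gd; apply: has_diff0_add => //; apply: has_diff0_opp. Qed.

(** Every factor equals 1 at the origin, so in the product rule all cofactors are 1. *)
Lemma has_diff0_prod1 I (s : seq I) (l : I -> 'Hom(W, K^o)) :
  has_diff0 (fun w => \prod_(i <- s) (1 + l i w)) (\sum_(i <- s) l i).
Proof.
elim: s => [|i s IH].
  under eq_fun do rewrite big_nil.
  rewrite big_nil; exact: has_diff0_cst.
under eq_fun do rewrite big_cons.
have := has_diff0_mul (has_diff0_linear 1 (l i)) IH.
rewrite big1 ?scale1r => [|j _]; last by rewrite linear0 addr0.
by rewrite linear0 addr0 scale1r big_cons.
Qed.

Lemma has_diff0_sum I (s : seq I) (f : I -> W -> K) l :
  (forall i, has_diff0 (f i) (l i)) ->
  has_diff0 (fun w => \sum_(i <- s) f i w) (\sum_(i <- s) l i).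
Proof.
move=> fl; elim: s => [|i s IH].
  under eq_fun do rewrite big_nil.
  rewrite big_nil; exact: has_diff0_cst.
under eq_fun do rewrite big_cons.
by rewrite big_cons; apply: has_diff0_add.
Qed.

(** The Zariski tangent space at the origin, taken with respect to all polynomial functions
    vanishing on [Z] rather than chosen generators of an ideal. *)
Definition tangent0 (Z : set W) : set W :=
  [set w | forall f l, has_diff0 f l -> (forall z, Z z -> f z = 0) -> l w = 0].

(** This linearises the normalisation that a numerator equals a denominator, both being products of
    affine forms with value 1 at the origin. *)
Lemma tangent0_prod (Z : set W) I (s s' : seq I) (l : I -> 'Hom(W, K^o)) w :
  tangent0 Z w ->
  (forall z, Z z -> \prod_(i <- s) (1 + l i z) = \prod_(i <- s') (1 + l i z)) ->
  \sum_(i <- s) (l i w : K) = \sum_(i <- s') (l i w : K).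
Proof.
move=> /(_ _ _ (has_diff0_sub (has_diff0_prod1 s l) (has_diff0_prod1 s' l))) tw lE.
apply/eqP; rewrite -subr_eq0 -[X in _ == X]tw => [|z /lE ->]; last by rewrite subrr.
by rewrite add_lfunE opp_lfunE !sum_lfunE.
Qed.

(** A determinant trick replaces local algebra. Each equation of [Z] has the form
    [\sum_i m i z * x_ i z = 0]; enough of them give a matrix with [row z *m M z = 0] and [M 0] of
    full row rank. Full rank persists where one determinant is nonzero, and there [z] must be 0. *)
Lemma isolated_origin (Z : set W) : Z 0 -> (forall w, tangent0 Z w -> w = 0) ->
  exists f, [/\ poly_fun f, f 0 != 0 & forall z, Z z -> f z != 0 -> z = 0].
Proof.
move=> Z0 Ztan; pose row w : 'rV[K]_n := \row_i x_ i w.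
(* Equations are collected by induction on the dimension of the subspace [V] on which their
   differentials at 0 have no common nonzero kernel vector; the whole space is the case needed. *)
suff H d (V : {vspace W}) : (\dim V < d)%N -> exists N (M : W -> 'M[K]_(n, N)),
    [/\ forall i j, poly_fun (fun w => M w i j),
        forall z, Z z -> row z *m M z = 0
      & forall w, w \in V -> row w *m M 0 = 0 -> w = 0].
  have [N [M [MP MZ Minj]]] := H _ _ (leqnn (\dim {:W}).+1).
  have /row_freeP[M' MM'] : row_free (M 0).
    apply: inj_row_free => v vM.
    pose w := \sum_i v ord0 i *: (vbasis {:W})`_i.
    have vE : row w = v.
      apply/rowP => i; rewrite mxE; apply: coord_sum_free.
      exact: basis_free (vbasisP _).
    have w0 : w = 0 by apply: Minj; rewrite ?memvf ?vE.
    by rewrite -vE w0; apply/rowP => i; rewrite !mxE linear0.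
  exists (fun w => \det (M w *m M')); split=> [||z Zz].
  - apply: (fa_det PA) => i j; under eq_fun do rewrite mxE.
    apply: (fa_sum PA) => k _; apply: (fa_mul PA) => //; exact: fa_cst PA _.
  - by rewrite MM' det1 oner_neq0.
  - rewrite -unitfE -unitmxE => Mz; apply: (Minj z (memvf z)).
    suff -> : row z = 0 by rewrite mul0mx.
    by rewrite -[row z](mulmxK Mz) mulmxA MZ // !mul0mx.
elim: d V => // d IH V Vd.
have [V0|V0] := eqVneq V 0%VS.
  exists 0, (fun=> 0); split=> [i [] //|z _|w]; first exact: mulmx0.
  by rewrite V0 memv0 => /eqP.
(* The nonzero vector [vpick V] is not tangent, so some equation of [Z] has a differential [l]
   detecting it, and [V :&: lker l] has smaller dimension. *)
have [f [l [[m [mP fE lE]] fZ lV]]] : exists f l,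
    [/\ has_diff0 f l, forall z, Z z -> f z = 0 & l (vpick V) != 0].
  apply: contrapT => H; move: V0; apply/negP; rewrite negbK -vpick0; apply/eqP.
  apply: Ztan => f l fd fZ; apply/eqP; apply: contrapT => lV.
  by apply: H; exists f, l; split=> //; apply/negP.
have [|N [M [MP MZ Minj]]] := IH (V :&: lker l)%VS.
  rewrite -ltnS (leq_trans _ Vd) // ltnS.
  have : (V :&: lker l != V)%VS.
    apply: contraNneq lV => VE; have := memv_pick V.
    by rewrite -{2}VE memv_cap memv_ker => /andP[].
  rewrite ltn_neqAle dimvS ?capvSl // andbT; apply: contra_neq => dE.
  by apply/eqP; rewrite -(geq_leqif (dimv_leqif_eq (capvSl V (lker l)))) dE.
(* The new column holds the coefficients of [f]: its product with [row z] is [f z - f 0], and at the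
   origin it computes [l]. *)
exists (N + 1)%N, (fun w => row_mx (M w) (\col_i m i w)); split=> [i j|z Zz|w wV].
- rewrite -[j]splitK; case: (fintype.split j) => k /=.
    by under eq_fun do rewrite row_mxEl.
  by under eq_fun do rewrite row_mxEr mxE.
- rewrite mul_mx_row MZ //.
  suff -> : row z *m \col_i m i z = 0 by rewrite row_mx0.
  apply/matrixP => i j; rewrite !mxE -[RHS](fZ z Zz) fE fZ // add0r.
  by apply: eq_bigr => k _; rewrite !mxE mulrC.
- rewrite mul_mx_row -row_mx0 => /eq_row_mx[Mw /matrixP/(_ ord0 ord0)].
  rewrite !mxE => lw.
  apply: Minj => //; rewrite memv_cap wV memv_ker lE -[X in _ == X]lw.
  by apply/eqP; apply: eq_bigr => k _; rewrite !mxE mulrC.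
Qed.

End IsolatedPoints.

(** * Degrees and derivations of a graded algebra *)

Section Functionals.
Variables (K : fieldType) (W : vectType K).

Lemma functional_neq0 (x : W) : x != 0 -> exists f : 'Hom(W, K^o), f x = 1.
Proof.
move=> x0; pose f i : {linear W -> K^o} := coord (vbasis {:W}) i.
have [i fi] : exists i, f i x != 0.
  apply: contrapT => h; move/eqP: x0; apply.
  rewrite (coord_vbasis (memvf x)) big1 // => i _; apply/eqP.
  by rewrite scaler_eq0; apply/orP; left; apply: contra_notT h => ?; exists i.
exists ((f i x)^-1 *: linfun (f i)).
by rewrite scale_lfunE lfunE /= [_ *: _]mulVf.
Qed.

End Functionals.

Section Degrees.
Variables (K : fieldType) (A : comFalgType K) (gr : grading A).

Lemma gr_ind (P : A -> Prop) : (forall q x, x \in gr q -> P x) ->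
  (forall x y, P x -> P y -> P (x + y)) -> forall x, P x.
Proof.
move=> Pgr PD x; rewrite [x](gr_proj_sum gr); apply: big_ind => //.
  exact: Pgr 0%N _ (mem0v _).
by move=> q _; apply: Pgr (gr_proj_mem _ _ _).
Qed.

Lemma gr_proj_bound N (x : A) : (gr_bound gr <= N)%N ->
  x = \sum_(q < N) gr_proj gr q x.
Proof.
move=> leN; rewrite [LHS](gr_proj_sum gr).
rewrite -!(big_mkord xpredT (fun q => gr_proj gr q x)).
rewrite [RHS](big_cat_nat _ leN) //= [X in _ = _ + X]big_nat_cond.
rewrite [X in _ = _ + X]big1 ?addr0 // => q.
rewrite andbT => /andP[le_q _]; apply/eqP.
by have := gr_proj_mem gr q x; rewrite gr_eq0 // memv0.
Qed.

(** Common shape of the Euler derivation and of the torus actions; [gr_scale] is the case where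
    [c q] is [t ^+ q]. *)
Definition gr_diag (c : nat -> K) : 'End(A) :=
  \sum_(q < gr_bound gr) c q *: gr_proj gr q.

Lemma gr_diagE c q x : x \in gr q -> gr_diag c x = c q *: x.
Proof.
move=> xq; rewrite sum_lfunE.
under eq_bigr => i _ do rewrite scale_lfunE (gr_projE _ xq).
have [lt_q|le_q] := ltnP q (gr_bound gr); last first.
  move: xq; rewrite gr_eq0 // memv0 => /eqP ->; rewrite scaler0 big1 // => i _.
  by rewrite if_same scaler0.
rewrite (bigD1 (Ordinal lt_q)) //= eqxx big1 ?addr0 // => i iq.
by rewrite ifN ?scaler0 // eq_sym; apply: contra_neq iq => ?; apply: val_inj.
Qed.

Lemma gr_diag_eq c c' :
  (forall q x, x \in gr q -> x != 0 -> c q = c' q) -> gr_diag c = gr_diag c'.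
Proof.
move=> cc'; apply/lfunP; apply: gr_ind => [q x xq|x y xE yE]; last first.
  by rewrite !linearD /= xE yE.
rewrite !(gr_diagE _ xq); have [->|x0] := eqVneq x 0; first by rewrite !scaler0.
by rewrite (cc' q x).
Qed.

Definition euler : 'End(A) := gr_diag (fun q => q%:R).

Lemma eulerE q x : x \in gr q -> euler x = q%:R *: x.
Proof. exact: gr_diagE. Qed.

Lemma Der_euler : Der gr 0 euler.
Proof.
split=> [q x xq|a b]; first by rewrite addr0 (eulerE xq) memvZ.
move: a; apply: (@gr_ind _) => [p x xp|x y Px Py]; last first.
  by rewrite mulrDl !linearD /= Px Py !mulrDl addrACA.
move: b; apply: (@gr_ind _) => [q y yq|y z Py Pz]; last first.
  by rewrite mulrDr !linearD /= Py Pz !mulrDr addrACA.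
rewrite (eulerE xp) (eulerE yq) (@eulerE (p + q)); last first.
  by apply: (subvP (gr_mul gr p q)); apply: memv_mul.
by rewrite natrD scalerDl scalerAl scalerAr.
Qed.

Hypothesis charK0 : [pchar K] =i pred0.
Hypothesis gr_conn : gr_connected gr.
Hypothesis Der_0 : set_dim (Der gr 0) 1.

(** In characteristic zero, a vanishing Euler derivation leaves no positive degree, so the connected
    algebra is the ground field, whose derivations are all 0, against dimension 1. *)
Lemma euler_neq0 : euler != 0.
Proof.
apply/eqP => e0; case: Der_0 => U DU dU.
have gr0 q : (0 < q)%N -> gr q = 0%VS.
  move=> q0; apply/eqP; rewrite -subv0; apply/subvP => x xq; rewrite memv0.
  have := eulerE xq; rewrite e0 zero_lfunE => /esym/eqP.
  by rewrite scaler_eq0 (pcharf0P K).1 // (gtn_eqF q0).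
have full (x : A) : x \in 1%VS.
  rewrite [x](gr_proj_sum gr) -gr_conn; apply: memv_suml => q _.
  have := gr_proj_mem gr q x; case: (posnP q) => [-> //|/gr0 ->].
  by rewrite memv0 => /eqP ->; apply: mem0v.
suff U0 : U = 0%VS by rewrite U0 dimv0 in dU.
apply/eqP; rewrite -subv0; apply/subvP => th thU; rewrite memv0.
have [_ thM] : Der gr 0 th by rewrite DU.
have th1 : th 1 = 0.
  by have /eqP := thM 1 1; rewrite !mulr1 mul1r -subr_eq0 opprD addNKr oppr_eq0 => /eqP.
apply/eqP/lfunP => x; have /vlineP[k ->] := full x.
by rewrite linearZ /= th1 scaler0 zero_lfunE.
Qed.

Lemma Der0_euler th : Der gr 0 th -> exists a, th = a *: euler.
Proof.
case: Der_0 => U DU dU; rewrite DU /= => thU; apply/vlineP.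
suff <- : U = <[euler]>%VS by [].
apply/esym/eqP; rewrite eqEdim dim_vline euler_neq0 dU leqnn andbT -memvE.
by have := Der_euler; rewrite DU.
Qed.

(** A vector of known weight together with a functional normalised on it: the data of a diagonal
    matrix coefficient with value 1 at the identity. *)
Record homogeneous_coord := HomogeneousCoord {
  hc_deg : nat;
  hc_vec : A;
  hc_fun : 'Hom(A, K^o);
  hc_mem : hc_vec \in gr hc_deg;
  hc_fun1 : hc_fun hc_vec = 1 }.

(* The torus acting through the degree has a character lattice generated by the
   gcd of the degrees occurring in [A]; a Bezout relation for it makes
   [\prod_(x <- ds_num) _ / \prod_(x <- ds_den) _] a rational function of
   weight [ds_gcd], hence a coordinate on this torus. *)
Record degree_section := DegreeSection {
  ds_gcd : nat;
  ds_num : seq homogeneous_coord;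
  ds_den : seq homogeneous_coord;
  ds_gcd_gt0 : (0 < ds_gcd)%N;
  ds_gcd_dvd : forall q x, x \in gr q -> x != 0 -> (ds_gcd %| q)%N;
  ds_bezout : (\sum_(x <- ds_num) hc_deg x =
               ds_gcd + \sum_(x <- ds_den) hc_deg x)%N }.

Lemma hc_exists q x : x \in gr q -> x != 0 ->
  exists h : homogeneous_coord, hc_deg h = q.
Proof.
by move=> xq /functional_neq0[f fx]; exists (HomogeneousCoord xq fx).
Qed.

(** Euclidean division: differences of sums of occurring degrees are stable under subtraction, so
    the least positive one divides every occurring degree. A positive one exists because the Euler
    derivation is nonzero. *)
Lemma degree_section_exists : exists D : degree_section, True.
Proof.
pose S (m : nat) := exists s s' : seq homogeneous_coord,
  (\sum_(x <- s) hc_deg x = m + \sum_(x <- s') hc_deg x)%N.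
have Sq q x : x \in gr q -> x != 0 -> S q.
  move=> xq /(hc_exists xq)[h hq]; exists [:: h], [::].
  by rewrite big_seq1 big_nil addn0.
(* Subtracting exchanges the two lists of the second relation. *)
have Ssub m m' : S m -> S m' -> (m' <= m)%N -> S (m - m')%N.
  move=> [s [s' sE]] [u [u' uE]] le_m; exists (s ++ u'), (s' ++ u).
  by rewrite !big_cat /= sE uE -{1}(subnK le_m) -!addnA (addnCA m').
have [g [/andP[g0 /asboolP Sg] gmin]] : exists g,
    (0 < g)%N && `[< S g >] /\ forall m, (0 < m)%N && `[< S m >] -> (g <= m)%N.
  have ex : exists g, (0 < g)%N && `[< S g >].
    have [q [x [q0 xq x0]]] : exists q x, [/\ (0 < q)%N, x \in gr q & x != 0].
      apply: contrapT => H; move/eqP: euler_neq0; apply; apply/lfunP.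
      apply: (@gr_ind _) => [q x xq|x y xE yE]; last first.
        by rewrite !linearD /= xE yE zero_lfunE.
      rewrite (eulerE xq) zero_lfunE; have [->|q0] := posnP q; first by rewrite scale0r.
      have [->|x0] := eqVneq x 0; first by rewrite scaler0.
      by case: H; exists q, x.
    by exists q; rewrite q0; apply/asboolP/Sq/x0.
  by exists (ex_minn ex); case: ex_minnP.
have [s [s' sE]] := Sg.
suff dvd q x : x \in gr q -> x != 0 -> (g %| q)%N.
  by exists (DegreeSection g0 dvd sE).
(* Removing [g] repeatedly from [q] keeps the difference in [S]; the remainder modulo [g] is
   reached, and minimality of [g] makes it 0. *)
move=> xq x0; have Sr k : (k * g <= q)%N -> S (q - k * g)%N.
  elim: k => [|k IH] le_k; first by rewrite mul0n subn0; apply: Sq x0.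
  rewrite mulSn addnC subnDA; apply: Ssub => //.
    by apply: IH; apply: leq_trans le_k; rewrite leq_pmul2r.
  by rewrite leq_subRL ?(leq_trans _ le_k) ?leq_pmul2r // addnC -mulSn.
rewrite /dvdn eqn0Ngt; apply/negP => r0; have := ltn_pmod q g0.
rewrite ltnNge gmin // r0; apply/asboolP.
have -> : (q %% g = q - q %/ g * g)%N by rewrite {2}(divn_eq q g) addKn.
by apply: Sr; rewrite leq_trunc_div.
Qed.

End Degrees.

(** * Derivations of a tensor product *)

Section TensorFactors.
Variables (K : fieldType) (I : finType) (B : I -> comFalgType K).
Local Notation T := (tensor B).
Implicit Types (j : I) (b : forall i, B i) (phi : forall i, 'Hom(B i, K^o)).

Lemma tensor_ext_linear (W : vectType K) (f g : T -> W) : linear f -> linear g ->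
  (forall b, f (pure b) = g (pure b)) -> f =1 g.
Proof.
move=> fl gl; pose Mf := GRing.isLinear.Build _ _ _ _ f fl.
pose Mg := GRing.isLinear.Build _ _ _ _ g gl.
pose fL : {linear T -> W} := HB.pack f Mf.
pose gL : {linear T -> W} := HB.pack g Mg.
exact: (@tensor_ext _ _ _ _ fL gL).
Qed.

Definition iota j (x : B j) : T := pure (dfwith (fun i => 1 : B i) j x).

Lemma iota_linear j : linear (@iota j).
Proof. exact: pure_multilinear. Qed.

HB.instance Definition _ j :=
  GRing.isLinear.Build K (B j) T _ (@iota j) (@iota_linear j).

Lemma iotaM j x y : iota (x * y : B j) = iota x * iota y.
Proof.
rewrite pureM; congr pure; apply: functional_extensionality_dep => i.
by case: dfwithP => [|i' ji']; rewrite ?dfwithin ?dfwithout ?mulr1.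
Qed.

(** The factors generate the tensor product as an algebra, so a derivation is determined by its
    values on them. *)
Lemma pure_prod_iota b : pure b = \prod_j iota (b j).
Proof.
have pprod (s : seq I) (F : I -> forall i, B i) :
    \prod_(j <- s) pure (F j) = pure (fun i => \prod_(j <- s) F j i).
  elim: s => [|j s IH]; last first.
    rewrite big_cons IH pureM; congr pure.
    by apply: functional_extensionality_dep => i; rewrite big_cons.
  rewrite big_nil -pure1; congr pure.
  by apply: functional_extensionality_dep => i; rewrite big_nil.
rewrite pprod; congr pure; apply: functional_extensionality_dep => i.
rewrite (bigD1 i) //= dfwithin big1 ?mulr1 // => j ji.
by rewrite dfwithout.
Qed.

(** The slice map: the functionals [phi i] are applied to the factors other than [B j], which is
    kept. *)
Definition contraction_form j phi b : B j :=
  (\prod_(i | i != j) (phi i (b i) : K)) *: b j.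

Lemma contraction_multilinear j phi : multilinear (contraction_form j phi).
Proof.
move=> k b a x y; rewrite /contraction_form.
case: (eqVneq k j) x y => [->|kj] x y.
  rewrite !dfwithin scalerDr !scalerA mulrC; congr (_ *: _ + _ *: _).
    congr (_ * _); apply: eq_bigr => i ij.
    by rewrite !dfwithout // eq_sym.
  by apply: eq_bigr => i ij; rewrite !dfwithout // eq_sym.
rewrite !(dfwithout _ _ kj) scalerA -scalerDl; congr (_ *: _).
rewrite !(bigD1 k kj) /= !dfwithin linearP /= mulrDl -mulrA.
congr (_ * (_ * _) + _ * _); apply: eq_bigr => i /andP[_ ik];
  by rewrite !dfwithout // eq_sym.
Qed.

Definition contraction j phi : T -> B j := tensor_lift (contraction_form j phi).

HB.instance Definition _ j phi := GRing.Linear.on (@contraction j phi).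

Lemma contraction_pure j phi b :
  contraction j phi (pure b) = (\prod_(i | i != j) (phi i (b i) : K)) *: b j.
Proof. exact/tensor_lift_pure/contraction_multilinear. Qed.

(** Linearity over [B j]: this is what turns a contracted derivation into a derivation of [B j]. *)
Lemma contraction_iotaM j phi (x : B j) (y : T) :
  contraction j phi (iota x * y) = x * contraction j phi y.
Proof.
move: y; apply: tensor_ext_linear => [a y y'|a y y'|b].
- by rewrite mulrDr -scalerAr linearP.
- by rewrite linearP mulrDr -scalerAr.
rewrite pureM !contraction_pure dfwithin -scalerAr; congr (_ *: _).
by apply: eq_bigr => i ij; rewrite dfwithout ?mul1r // eq_sym.
Qed.

Lemma contraction_iota j phi (x : B j) :
  (forall i, phi i 1 = 1) -> contraction j phi (iota x) = x.
Proof.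
move=> phi1; rewrite contraction_pure dfwithin big1 ?scale1r // => i ij.
by rewrite dfwithout // eq_sym.
Qed.

Lemma tensor_map_iota j (f : forall i, 'End(B i)) (x : B j) :
  (forall i, f i 1 = 1) -> tensor_map f (iota x) = iota (f j x).
Proof.
move=> f1; rewrite tensor_map_pure; congr pure.
apply: functional_extensionality_dep => i.
have [ji|ji] := eqVneq j i; last by rewrite !dfwithout ?f1.
by case: i / ji; rewrite !dfwithin.
Qed.

End TensorFactors.

(** * Rigidity of the degree 0 derivations of a tensor product *)

Section DerivationRigidity.
Variables (K : fieldType) (I : finType) (B : I -> comFalgType K).
Variable gr : forall j, grading (B j).
Local Notation T := (tensor B).
Local Notation grT := (tensor_grading gr).
Implicit Types (j : I) (b : forall i, B i) (phi : forall i, 'Hom(B i, K^o)).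

Lemma iota_part j q (x : B j) : x \in gr j q -> iota x \in grT q.
Proof.
move=> xq; pose d i := if i == j then q else 0%N.
have -> : q = (\sum_i d i)%N.
  by rewrite (bigD1 j) //= /d eqxx big1 ?addn0 // => i /negPf ->.
apply: pure_tensor_part => i; rewrite /d.
case: dfwithP => [|i' ji']; first by rewrite eqxx.
by rewrite eq_sym (negPf ji') gr_one.
Qed.

(** On a homogeneous pure tensor, either the degrees off [j] agree with [p] and are removed exactly,
    or some functional vanishes. A negative target degree means the value 0, through [gr_int]. *)
Lemma contraction_part j phi (p : I -> nat) n (z : T) :
  (forall i q x, x \in gr i q -> q != p i -> phi i x = 0) ->
  z \in grT n ->
  contraction j phi z \in gr_int (gr j) (n%:Z - (\sum_(i | i != j) p i)%N%:Z).
Proof.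
move=> phi_p; pose k : {linear T -> B j} := contraction j phi.
set V := gr_int _ _ => zn.
suff /subvP/(_ z zn) : (tensor_part gr n <= linfun k @^-1: V)%VS.
  by rewrite -memv_preim lfunE.
apply/tensor_partP => d b dn bd; rewrite -memv_preim lfunE /= contraction_pure.
have [/forallP dp|/forallPn[i]] := boolP [forall i, (i != j) ==> (d i == p i)].
  have nE : n = (d j + \sum_(i | i != j) p i)%N.
    rewrite -dn (bigD1 j) //=; congr (_ + _)%N; apply: eq_bigr => i ij.
    by apply/eqP; move: (dp i); rewrite ij.
  by rewrite /V nE PoszD addrK; apply: memvZ (bd j).
rewrite negb_imply => /andP[ij dpi].
by rewrite (bigD1 i) //= (phi_p i (d i)) // mul0r scale0r mem0v.
Qed.

Lemma Der_contraction j phi (p : I -> nat) th :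
  (forall i q x, x \in gr i q -> q != p i -> phi i x = 0) ->
  Der grT 0 th ->
  exists2 th', Der (gr j) (- (\sum_(i | i != j) p i)%N%:Z) th' &
    forall x, th' x = contraction j phi (th (iota x)).
Proof.
move=> phi_p [thgr thM].
exists (linfun (contraction j phi \o (th \o @iota _ _ B j))) => [|x]; last first.
  by rewrite lfunE.
split=> [q x xq|x y]; rewrite !lfunE /=.
  apply: contraction_part phi_p _.
  by have := thgr q _ (iota_part xq); rewrite addr0.
rewrite iotaM thM linearD /= (contraction_iotaM phi x) [th _ * _]mulrC.
by rewrite (contraction_iotaM phi y) [y * _]mulrC.
Qed.

Variable eps : forall i, 'Hom(B i, K^o).
Hypothesis epsE : forall i x, gr_proj (gr i) 0 x = (eps i x : K) *: 1.

Lemma eps_homog i q x : x \in gr i q -> q != 0%N -> eps i x = 0.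
Proof.
move=> xq q0; have /esym/eqP := epsE x.
by rewrite (gr_projE _ xq) (negPf q0) scaler_eq0 oner_eq0 orbF => /eqP.
Qed.

Lemma eps1 i : eps i 1 = 1.
Proof.
have /esym/eqP := epsE (1 : B i); rewrite (gr_projE _ (gr_one (gr i))) eqxx.
rewrite -[X in _ == X]scale1r -subr_eq0 -scalerBl scaler_eq0 oner_eq0 orbF.
by rewrite subr_eq0 => /eqP.
Qed.

(** Splitting each basis functional by degree shows that contractions against homogeneous
    functionals detect every element. The sum of all bounds serves as [N] so that one index type
    covers every factor. *)
Lemma tensor_coord_contraction j u (z : T) :
  let N := (\sum_i gr_bound (gr i))%N in
  z u = \sum_(p : {ffun I -> 'I_N}) coord (vbasis {:B j}) (u j)
    (gr_proj (gr j) (p j) (contraction j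
       (fun i => linfun (coord (vbasis {:B i}) (u i) : _ -> K^o) \o
          gr_proj (gr i) (p i))%VF z)).
Proof.
move=> N; move: z; apply: (@tensor_ext_linear _ _ _ K^o) => [a x y|a x y|b].
- by rewrite !ffunE.
- rewrite scaler_sumr -big_split /=; apply: eq_bigr => p _.
  by rewrite !linearP.
have le_N i : (gr_bound (gr i) <= N)%N by rewrite /N (bigD1 i) //= leq_addr.
rewrite ffunE /coord_prod.
under eq_bigr => i _ do rewrite [b i](gr_proj_bound _ (le_N i)) linear_sum.
rewrite bigA_distr_bigA; apply: eq_bigr => p _.
rewrite contraction_pure !linearZ /= (bigD1 j) //= mulrC; congr (_ * _).
by apply: eq_bigr => i _; rewrite comp_lfunE lfunE.
Qed.

Hypothesis Der_neg : forall j (p : int), p < 0 -> Der (gr j) p = [set 0].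

(** Contractions of positive total degree give derivations of negative degree, which vanish; the
    remaining ones are multiples of the contraction by the augmentations. The Leibniz rule then
    passes from the factors to all of [T]. *)
Lemma Der_tensor_eq0 th : Der grT 0 th ->
  (forall j (x : B j), contraction j eps (th (iota x)) = 0) -> th = 0.
Proof.
move=> thD thc; have [_ thM] := thD.
have th0 j (x : B j) : th (iota x) = 0.
  apply/ffunP => u; rewrite (tensor_coord_contraction j) ffunE big1 // => p _.
  set phi := (X in contraction j X).
  suff -> : contraction j phi (th (iota x)) = 0 by rewrite !linear0.
  have phi_p i q (y : B i) : y \in gr i q -> q != p i -> phi i y = 0.
    by move=> yq qp; rewrite comp_lfunE (gr_projE _ yq) (negPf qp) linear0.
  have [p0|p0] := posnP (\sum_(i | i != j) p i)%N; last first.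
    have [th' + <-] := Der_contraction j phi_p thD.
    by rewrite Der_neg ?Num.Theory.oppr_lt0 ?ltz_nat // => ->; rewrite zero_lfunE.
  (* All degrees off [j] are 0 here, and a functional supported in degree 0 is a scalar multiple of
     the augmentation. *)
  have phiE : contraction j phi =1 (fun z =>
      (\prod_(i | i != j) coord (vbasis {:B i}) (u i) 1) *: contraction j eps z).
    apply: tensor_ext_linear => [||b]; first exact: linearP.
      move=> a y z; rewrite linearP scalerDr !scalerA; congr (_ *: _ + _).
      exact: mulrC.
    rewrite !contraction_pure scalerA -big_split; congr (_ *: _).
    apply: eq_bigr => i ij; rewrite comp_lfunE lfunE /=.
    have -> : p i = 0%N :> nat.
      by apply/eqP; move/eqP: p0; rewrite sum_nat_eq0 => /forall_inP/(_ i ij).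
    by rewrite epsE linearZ mulrC.
  by rewrite phiE thc scaler0.
apply/lfunP; apply: tensor_ext_linear => [||b]; try exact: linearP.
rewrite zero_lfunE pure_prod_iota; apply: (big_ind (fun z => th z = 0)) => [||j _].
- by have /eqP := thM 1 1; rewrite !mulr1 mul1r -subr_eq0 opprD addNKr oppr_eq0 => /eqP.
- by move=> x y thx thy; rewrite thM thx thy mul0r mulr0 addr0.
- exact: th0.
Qed.

Definition section_coef j (x : homogeneous_coord (gr j)) (h : 'End(T)) : K :=
  hc_fun x (contraction j eps (h (iota (hc_vec x)))).

Definition section_form j (x : homogeneous_coord (gr j)) : 'Hom('End(T), K^o) :=
  linfun (hc_fun x \o (contraction j eps \o eval_at (iota (hc_vec x)))).

Lemma section_formE j x h : section_form (j:=j) x h = section_coef x h.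
Proof. by rewrite lfunE. Qed.

Hypothesis charK0 : [pchar K] =i pred0.
Hypothesis gr_conn : forall j, gr_connected (gr j).
Hypothesis Der_0 : forall j, set_dim (Der (gr j) 0) 1.
Variable D : forall j, degree_section (gr j).

(** On each factor the contraction by augmentations is [a] times the Euler derivation, with
    coefficients [a] times degrees. By the Bezout relation, equality of the two sums says [a] times
    [ds_gcd] is 0, so [a] is 0 in characteristic zero. *)
Lemma Der_tensor_rigid th : Der grT 0 th ->
  (forall j, \sum_(x <- ds_num (D j)) section_coef x th =
             \sum_(x <- ds_den (D j)) section_coef x th) -> th = 0.
Proof.
move=> thD thN; apply: Der_tensor_eq0 => // j.
have [th' + th'E] := Der_contraction j (p:=fun=> 0%N) eps_homog thD.
rewrite big1 // oppr0 => /(Der0_euler charK0 (gr_conn j) (Der_0 j))[a aE].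
have coefE (x : homogeneous_coord (gr j)) : section_coef x th = a * (hc_deg x)%:R.
  rewrite /section_coef -th'E aE scale_lfunE (eulerE (hc_mem x)) !linearZ /=.
  by rewrite hc_fun1 [_ *: 1]mulr1.
have /eqP := thN j; under eq_bigr do rewrite coefE.
under [X in _ == X]eq_bigr do rewrite coefE.
rewrite -!mulr_sumr -!natr_sum ds_bezout natrD mulrDr.
rewrite addrC -subr_eq0 addrAC subrr add0r.
rewrite mulf_eq0 (pcharf0P K).1 // gtn_eqF ?ds_gcd_gt0 // orbF => /eqP a0 x.
by rewrite -th'E aE a0 scale0r zero_lfunE.
Qed.

End DerivationRigidity.

(** * The torus action *)

Section GradedAutomorphisms.
Variables (K : fieldType) (A : falgType K) (gr : grading A).

Lemma gr_aut_id : gr_aut gr \1%VF.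
Proof.
split=> [||a b|q]; rewrite ?id_lfunE //.
  by rewrite -subv0; apply/subvP => x; rewrite memv_ker id_lfunE memv0.
by rewrite lim1g.
Qed.

Lemma gr_autP g : gr_aut gr g <->
  [/\ lker g == 0%VS, g 1 = 1, forall a b, g (a * b) = g a * g b
    & forall q x, x \in gr q -> g x \in gr q].
Proof.
split=> -[gi g1 gM gq]; split=> // q.
  by move=> x xq; apply: (subvP (gq q)); apply: memv_img.
by apply/subvP => _ /memv_imgP[x xq ->]; apply: gq.
Qed.

Lemma gr_aut_comp f g : gr_aut gr f -> gr_aut gr g -> gr_aut gr (f \o g)%VF.
Proof.
move=> /gr_autP[fi f1 fM fq] /gr_autP[gi g1 gM gq]; apply/gr_autP.
split=> [||a b|q x xq]; rewrite ?comp_lfunE.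
- apply/lker0P => x y; rewrite !comp_lfunE.
  by move=> /(lker0P fi)/(lker0P gi).
- by rewrite g1 f1.
- by rewrite gM fM.
- exact/fq/gq.
Qed.

Lemma gr_aut_inv f : gr_aut gr f -> gr_aut gr (f^-1)%VF.
Proof.
move=> /gr_autP[fi f1 fM fq]; have fK := lker0_lfunK fi.
have fVK := lker0_lfunVK fi.
apply/gr_autP; split=> [||a b|q x xq].
- by apply/lker0P => x y xy; rewrite -[x]fVK xy fVK.
- by rewrite -{1}f1 fK.
- by rewrite -{1}[a]fVK -{1}[b]fVK -fM fK.
have fqE : (f @: gr q)%VS = gr q.
  apply/eqP; rewrite eqEdim limg_dim_eq ?leqnn ?andbT; last first.
    by rewrite (eqP fi) capv0.
  by apply/subvP => _ /memv_imgP[y yq ->]; apply: fq.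
by move: xq; rewrite -{1}fqE => /memv_imgP[y yq ->]; rewrite fK.
Qed.

End GradedAutomorphisms.

Section TensorMaps.
Variables (K : fieldType) (I : finType) (B : I -> comFalgType K).

Lemma tensor_map_comp (f g : forall i, 'End(B i)) :
  tensor_map (fun i => f i \o g i)%VF = (tensor_map f \o tensor_map g)%VF.
Proof.
apply/lfunP; apply: tensor_ext_linear => [||b]; try exact: linearP.
rewrite comp_lfunE !tensor_map_pure; congr pure.
by apply: functional_extensionality_dep => i; rewrite comp_lfunE.
Qed.

Lemma tensor_map_id (f : forall i, 'End(B i)) :
  (forall i, f i = \1%VF) -> tensor_map f = \1%VF.
Proof.
move=> f1; apply/lfunP; apply: tensor_ext_linear => [||b]; try exact: linearP.
rewrite id_lfunE tensor_map_pure; congr pure.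
by apply: functional_extensionality_dep => i; rewrite f1 id_lfunE.
Qed.

Lemma tensor_map_eq (f g : forall i, 'End(B i)) :
  (forall i, f i = g i) -> tensor_map f = tensor_map g.
Proof. by move=> fg; congr tensor_map; apply: functional_extensionality_dep. Qed.

Lemma tensor_map_mul (f : forall i, 'End(B i)) :
  (forall i a b, f i (a * b) = f i a * f i b) ->
  forall x y, tensor_map f (x * y) = tensor_map f x * tensor_map f y.
Proof.
move=> fM x y; move: x; apply: tensor_ext_linear => [a x x'|a x x'|b].
- by rewrite mulrDl -scalerAl linearP.
- by rewrite linearP mulrDl -scalerAl.
move: y; apply: tensor_ext_linear => [a y y'|a y y'|b'].
- by rewrite mulrDr -scalerAr linearP.
- by rewrite linearP mulrDr -scalerAr.
rewrite pureM !tensor_map_pure pureM; congr pure.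
by apply: functional_extensionality_dep => i; apply: fM.
Qed.

Lemma fa_map_pure (X : Type) (S : set (X -> K)) (beta : forall i, X -> B i) :
  function_algebra S -> (forall i, fa_map S (beta i)) ->
  fa_map S (fun x => pure (fun i => beta i x)).
Proof.
move=> SA betaS.
have -> : (fun x => pure (fun i => beta i x)) =
    fun x => \sum_u coord_prod u (fun i => beta i x) *: pure (basis_family u).
  apply/funext => x; rewrite [LHS]tensor_expand.
  by apply: eq_bigr => u _; rewrite ffunE.
apply: fa_map_lincomb => // u; last exact: fa_map_cst.
by apply: fa_prod => // i _; apply: betaS.
Qed.

Lemma fa_map_tensor_map (X : Type) (S : set (X -> K)) (f : forall i, X -> 'End(B i)) :
  function_algebra S -> (forall i, fa_map S (f i)) ->
  fa_map S (fun x => tensor_map (fun i => f i x)).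
Proof.
move=> SA fS; apply: fa_map_lfun => // v.
have -> : (fun x => tensor_map (fun i => f i x) v) = fun x =>
    \sum_u v u *: pure (fun i => f i x (basis_family u i)).
  apply/funext => x; rewrite {1}[v]tensor_expand linear_sum.
  by apply: eq_bigr => u _; rewrite linearZ /= tensor_map_pure.
apply: fa_map_lincomb => // u; first exact: (fa_cst SA).
apply: fa_map_pure => // i; apply: fa_map_app => //; exact: fa_map_cst.
Qed.

End TensorMaps.

Lemma gr_scaleM (K : fieldType) (A : comFalgType K) (gr : grading A) t (a b : A) :
  gr_scale gr t (a * b) = gr_scale gr t a * gr_scale gr t b.
Proof.
move: a; apply: (gr_ind (gr := gr)) => [p x xp|x y Px Py]; last first.
  by rewrite mulrDl !linearD /= Px Py mulrDl.
move: b; apply: (gr_ind (gr := gr)) => [q y yq|y z Py Pz]; last first.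
  by rewrite mulrDr !linearD /= Py Pz mulrDr.
rewrite (gr_scaleE _ xp) (gr_scaleE _ yq) (@gr_scaleE _ _ _ _ (p + q)); last first.
  by apply: (subvP (gr_mul gr p q)); apply: memv_mul.
by rewrite exprD -scalerAl -scalerAr scalerA.
Qed.

Section TorusAction.
Variables (K : closedFieldType) (r : nat) (B : 'I_r -> comFalgType K).
Variable gr : forall j, grading (B j).
Local Notation T := (tensor B).
Local Notation grT := (tensor_grading gr).
Implicit Types s t : 'rV[K]_r.

Lemma torus_actionM s t : torus_action gr (std_torus_mul s t) =
  (torus_action gr s \o torus_action gr t)%VF.
Proof.
rewrite /torus_action -tensor_map_comp; apply: tensor_map_eq => j.
apply/lfunP; apply: (gr_ind (gr := gr j)) => [q x xq|x y xE yE]; last first.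
  by rewrite !linearD /= xE yE.
by rewrite comp_lfunE !(gr_scaleE _ xq) linearZ /= (gr_scaleE _ xq) mxE scalerA
  exprMn mulrC.
Qed.

Lemma torus_action1 : torus_action gr (const_mx 1) = \1%VF.
Proof.
apply: tensor_map_id => j; apply/lfunP.
apply: (gr_ind (gr := gr j)) => [q x xq|x y xE yE]; last first.
  by rewrite !linearD /= xE yE.
by rewrite (gr_scaleE _ xq) mxE expr1n scale1r id_lfunE.
Qed.

Definition std_torus_inv t : 'rV[K]_r := \row_j (t ord0 j)^-1.

Lemma std_torus_invP t : std_torus t -> std_torus (std_torus_inv t).
Proof. by move=> t0 j; rewrite mxE invr_eq0; apply: t0. Qed.

Lemma torus_actionV t : std_torus t ->
  (torus_action gr t \o torus_action gr (std_torus_inv t) = \1)%VF.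
Proof.
move=> t0; rewrite -torus_actionM -torus_action1; congr torus_action.
by apply/rowP => j; rewrite !mxE mulfV //; apply: t0.
Qed.

Lemma torus_actionVl t : std_torus t ->
  (torus_action gr (std_torus_inv t) \o torus_action gr t = \1)%VF.
Proof.
move=> t0; rewrite -torus_actionM -torus_action1; congr torus_action.
by apply/rowP => j; rewrite !mxE mulVf //; apply: t0.
Qed.

Lemma torus_action_aut t : std_torus t -> gr_aut grT (torus_action gr t).
Proof.
move=> t0; apply/gr_autP; split=> [||a b|q x xq].
- apply/lker0P => x y xy.
  by rewrite -[x]id_lfunE -[y]id_lfunE -(torus_actionVl t0) !comp_lfunE xy.
- rewrite -pure1 tensor_map_pure; congr pure.
  apply: functional_extensionality_dep => j.
  by rewrite (gr_scaleE _ (gr_one _)) scale1r.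
- by apply: tensor_map_mul => j; apply: gr_scaleM.
suff /subvP/(_ x xq) : (tensor_part gr q <= torus_action gr t @^-1: grT q)%VS.
  by rewrite -memv_preim.
apply/tensor_partP => d b <- bd; rewrite -memv_preim tensor_map_pure.
by apply: pure_tensor_part => j; rewrite (gr_scaleE _ (bd j)) memvZ ?bd.
Qed.

Lemma torus_action_inv t : std_torus t ->
  ((torus_action gr t)^-1 = torus_action gr (std_torus_inv t))%VF.
Proof.
move=> t0; have /gr_autP[ti _ _ _] := torus_action_aut t0.
apply/lfunP => x; apply: (lker0P ti).
by rewrite lker0_lfunVK // -comp_lfunE torus_actionV // id_lfunE.
Qed.

(* [root_action] factors the torus action through its effective quotient. *)
Variable D : forall j, degree_section (gr j).

Definition root_action s : 'End(T) :=
  tensor_map (fun j => gr_diag (gr j) (fun q => s ord0 j ^+ (q %/ ds_gcd (D j)))).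

(** Every degree that occurs is a multiple of [ds_gcd], so [t ^+ q] is a power of [t ^+ ds_gcd]. *)
Lemma root_actionE s t : (forall j, t ord0 j ^+ ds_gcd (D j) = s ord0 j) ->
  root_action s = torus_action gr t.
Proof.
move=> ts; apply: tensor_map_eq => j; apply: gr_diag_eq => q x xq x0.
by rewrite -ts -exprM mulnC divnK // (ds_gcd_dvd (D j) xq x0).
Qed.

Lemma torus_root s : exists t, forall j, t ord0 j ^+ ds_gcd (D j) = s ord0 j.
Proof.
have root n (c : K) : (0 < n)%N -> exists y, y ^+ n = c.
  move=> n0; have /closed_rootP[y] : size ('X^n - c%:P : {poly K}) != 1%N.
    by rewrite size_XnsubC // eqSS -lt0n.
  by rewrite rootE !hornerE subr_eq0 => /eqP; exists y.
have /choice[t tE] j := root _ (s ord0 j) (ds_gcd_gt0 (D j)).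
by exists (\row_j t j) => j; rewrite mxE.
Qed.

Lemma torus_root_std s t : (forall j, t ord0 j ^+ ds_gcd (D j) = s ord0 j) ->
  std_torus s <-> std_torus t.
Proof.
move=> ts; split=> h j; have := h j; rewrite -ts expf_eq0 ds_gcd_gt0 //.
Qed.

(** The field being algebraically closed, raising coordinates to the powers [ds_gcd] maps the torus
    onto itself. *)
Lemma root_action_image :
  root_action @` @std_torus K r = torus_action gr @` @std_torus K r.
Proof.
apply/seteqP; split=> _ [s s0 <-].
  have [t ts] := torus_root s; exists t; first exact/(torus_root_std ts).
  by rewrite (root_actionE ts).
pose s' : 'rV[K]_r := \row_j s ord0 j ^+ ds_gcd (D j).
have ss' j : s ord0 j ^+ ds_gcd (D j) = s' ord0 j by rewrite mxE.
by exists s'; [apply/(torus_root_std ss') | apply: root_actionE].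
Qed.

Lemma root_actionM s t : root_action (std_torus_mul s t) =
  (root_action s \o root_action t)%VF.
Proof.
have [s' ss'] := torus_root s; have [t' tt'] := torus_root t.
rewrite (root_actionE ss') (root_actionE tt') -torus_actionM.
by apply: root_actionE => j; rewrite !mxE exprMn ss' tt'.
Qed.

Lemma root_action1 : root_action (const_mx 1) = \1%VF.
Proof. by rewrite -torus_action1; apply: root_actionE => j; rewrite !mxE expr1n. Qed.

Lemma root_action_aut s : std_torus s -> gr_aut grT (root_action s).
Proof.
have [t ts] := torus_root s; move/(torus_root_std ts) => t0.
by rewrite (root_actionE ts); apply: torus_action_aut.
Qed.

Lemma fa_map_gr_diag (X : Type) (S : set (X -> K)) j (c : X -> nat -> K) :
  function_algebra S -> (forall q, S (c^~ q)) ->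
  fa_map S (fun x => gr_diag (gr j) (c x)).
Proof.
move=> SA cS; apply: (@fa_map_lincomb _ _ _ SA _ 'I_(gr_bound (gr j)) _
  (fun q x => c x q) (fun q _ => gr_proj (gr j) q)) => // q; exact: fa_map_cst.
Qed.

Lemma fa_map_root_action (X : Type) (S : set (X -> K)) (s : X -> 'rV[K]_r) :
  function_algebra S -> (forall j, S (fun x => s x ord0 j)) ->
  fa_map S (fun x => root_action (s x)).
Proof.
move=> SA sS; apply: fa_map_tensor_map => // j.
apply: (@fa_map_gr_diag _ _ j (fun x q => s x ord0 j ^+ (q %/ ds_gcd (D j))) SA).
by move=> q; apply: fa_exp.
Qed.

Lemma fa_map_torus_action (X : Type) (S : set (X -> K)) (s : X -> 'rV[K]_r) :
  function_algebra S -> (forall j, S (fun x => s x ord0 j)) ->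
  fa_map S (fun x => torus_action gr (s x)).
Proof.
move=> SA sS; apply: fa_map_tensor_map => // j.
apply: (@fa_map_gr_diag _ _ j (fun x q => s x ord0 j ^+ q) SA).
by move=> q; apply: fa_exp.
Qed.

End TorusAction.

(** * Automorphisms near the identity *)

Section TangentAutomorphisms.
Variables (K : fieldType) (A : falgType K) (gr : grading A).

Definition eval_form a (l : {linear A -> K^o}) : 'Hom('End(A), K^o) :=
  linfun (l \o eval_at a).

Lemma eval_formE a l w : eval_form a l w = l (w a).
Proof. by rewrite lfunE. Qed.

Lemma has_diff0_eval c a (l : {linear A -> K^o}) :
  has_diff0 (fun w : 'End(A) => c + l (w a)) (eval_form a l).
Proof.
have := has_diff0_linear c (eval_form a l).
by under eq_fun do rewrite eval_formE.
Qed.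

Lemma functionals_eq0 (x : A) : (forall l : {linear A -> K^o}, l x = 0) -> x = 0.
Proof.
move=> x0; rewrite (coord_vbasis (memvf x)) big1 // => i _.
by rewrite (x0 (coord (vbasis {:A}) i : {linear A -> K^o})) scale0r.
Qed.

(** Splits a functional of a product into finitely many products of functionals, so that
    multiplicativity becomes polynomial equations. *)
Lemma functional_mul (l : {linear A -> K^o}) :
  exists n (c m : 'I_n -> {linear A -> K^o}),
    forall x y, l (x * y) = \sum_k c k x * m k y.
Proof.
exists (\dim {:A}), (fun k => coord (vbasis {:A}) k : {linear A -> K^o}),
  (fun k => l \o amull (vbasis {:A})`_k : {linear A -> K^o}) => x y.
rewrite [x in LHS](coord_vbasis (memvf x)) mulr_suml linear_sum.
by apply: eq_bigr => k _; rewrite /= lfunE /= -scalerAl linearZ.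
Qed.

Lemma tangent0_gr_aut (Z : set 'End(A)) w :
  (forall z, Z z -> gr_aut gr (\1 + z)%VF) -> tangent0 Z w -> Der gr 0 w.
Proof.
move=> ZG tw; split=> [q x xq|a b].
  rewrite addr0 /=; suff -> : w x = gr_proj gr q (w x) by apply: gr_proj_mem.
  apply/eqP; rewrite -subr_eq0; apply/eqP/functionals_eq0 => l.
  have := tw _ _ (has_diff0_eval 0 x (l \o (\1 - gr_proj gr q)%VF)).
  rewrite eval_formE /= add_lfunE id_lfunE opp_lfunE => -> //.
  move=> z /ZG/gr_autP[_ _ _ /(_ q x xq)].
  rewrite add_lfunE id_lfunE => xzq; have zq : z x \in gr q.
    by rewrite -[z x](addKr x) memvD ?memvN.
  by rewrite add0r add_lfunE id_lfunE opp_lfunE (gr_projE _ zq) eqxx subrr linear0.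
apply/eqP; rewrite -subr_eq0; apply/eqP/functionals_eq0 => l.
have [n [c [m mE]]] := functional_mul l.
(* The equation is [l] applied to multiplicativity of [\1 + z] at [a] and [b]; its differential at 0
   is [l] applied to the Leibniz identity for [w]. *)
have := tw _ _ (has_diff0_sub (has_diff0_eval (l (a * b)) (a * b) l)
  (has_diff0_sum (index_enum _) (fun k =>
     has_diff0_mul (has_diff0_eval (c k a) a (c k)) (has_diff0_eval (m k b) b (m k))))).
rewrite add_lfunE opp_lfunE sum_lfunE eval_formE => <- => [|z /ZG/gr_autP[_ _ gM _]].
  rewrite linearB linearD !mE; congr (_ - _).
  rewrite -big_split; apply: eq_bigr => k _.
  rewrite add_lfunE !scale_lfunE !eval_formE !lfunE !linear0 !addr0.
  by congr (_ + _); apply: mulrC.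
have := congr1 l (gM a b).
rewrite !add_lfunE !id_lfunE [X in _ = X -> _]mE linearD => ->.
by rewrite -sumrB big1 // => k _; rewrite !linearD subrr.
Qed.

End TangentAutomorphisms.

(** * A rational section of the torus action and the slice through the identity *)

Section NearIdentity.
Variables (K : closedFieldType) (r : nat) (B : 'I_r -> comFalgType K).
Variable gr : forall j, grading (B j).
Local Notation T := (tensor B).
Local Notation grT := (tensor_grading gr).
Hypothesis charK0 : [pchar K] =i pred0.
Hypothesis gr_conn : forall j, gr_connected (gr j).
Hypothesis Der_neg : forall j (p : int), p < 0 -> Der (gr j) p = [set 0].
Hypothesis Der_0 : forall j, set_dim (Der (gr j) 0) 1.
Variable D : forall j, degree_section (gr j).
Variable eps : forall i, 'Hom(B i, K^o).
Hypothesis epsE : forall i x, gr_proj (gr i) 0 x = (eps i x : K) *: 1.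
Local Notation coef := (section_coef eps).

Lemma section_coef_id j (x : homogeneous_coord (gr j)) : coef x \1%VF = 1.
Proof.
by rewrite /section_coef id_lfunE contraction_iota ?hc_fun1 // => i; apply: eps1.
Qed.

Lemma hc_vec_neq0 j (x : homogeneous_coord (gr j)) : hc_vec x != 0.
Proof.
apply/eqP => x0; have /eqP := hc_fun1 x; rewrite x0 linear0.
by rewrite eq_sym oner_eq0.
Qed.

Lemma section_coef_root_action j (x : homogeneous_coord (gr j)) h s :
  coef x (h \o root_action D s)%VF =
  s ord0 j ^+ (hc_deg x %/ ds_gcd (D j)) * coef x h.
Proof.
rewrite /section_coef comp_lfunE tensor_map_iota => [|i]; last first.
  by rewrite (gr_diagE _ (gr_one _)) div0n expr0 scale1r.
by rewrite (gr_diagE _ (hc_mem x)) !linearZ.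
Qed.

Lemma sum_deg_div j (s : seq (homogeneous_coord (gr j))) :
  (\sum_(x <- s) hc_deg x %/ ds_gcd (D j) =
   (\sum_(x <- s) hc_deg x) %/ ds_gcd (D j))%N.
Proof.
elim: s => [|x s IH]; first by rewrite !big_nil div0n.
rewrite !big_cons IH divnDl //.
exact: ds_gcd_dvd (hc_mem x) (hc_vec_neq0 x).
Qed.

Definition num j (h : 'End(T)) : K := \prod_(x <- ds_num (D j)) coef x h.
Definition den j (h : 'End(T)) : K := \prod_(x <- ds_den (D j)) coef x h.

(** After division by [ds_gcd], the Bezout relation says that the total weights of numerator and
    denominator differ by exactly 1, so their quotient is a coordinate of weight 1. *)
Lemma num_den_root_action j h s : exists m,
  num j (h \o root_action D s)%VF = s ord0 j ^+ m.+1 * num j h /\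
  den j (h \o root_action D s)%VF = s ord0 j ^+ m * den j h.
Proof.
exists (\sum_(x <- ds_den (D j)) hc_deg x %/ ds_gcd (D j))%N.
have -> : (\sum_(x <- ds_den (D j)) hc_deg x %/ ds_gcd (D j)).+1 =
    (\sum_(x <- ds_num (D j)) hc_deg x %/ ds_gcd (D j))%N.
  by rewrite !sum_deg_div ds_bezout divnDl // divnn ds_gcd_gt0.
rewrite /num /den -!prodrXr -!big_split /=.
by split; apply: eq_bigr => x _; apply: section_coef_root_action.
Qed.

Definition section_map (h : 'End(T)) : 'rV[K]_r := \row_j (num j h / den j h).

Lemma num_id j : num j \1%VF = 1.
Proof. by rewrite /num big1 // => x _; apply: section_coef_id. Qed.

Lemma den_id j : den j \1%VF = 1.
Proof. by rewrite /den big1 // => x _; apply: section_coef_id. Qed.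

Lemma den_root_action j s : std_torus s -> den j (root_action D s) != 0.
Proof.
move=> s0; have [m [_]] := num_den_root_action j \1%VF s.
rewrite comp_lfun1l den_id mulr1 => ->; exact/expf_neq0/s0.
Qed.

Lemma section_map_root_action s : std_torus s ->
  section_map (root_action D s) = s.
Proof.
move=> s0; apply/rowP => j; rewrite mxE.
have [m []] := num_den_root_action j \1%VF s.
rewrite comp_lfun1l num_id den_id !mulr1 => -> ->.
by rewrite exprS mulfK //; apply/expf_neq0/s0.
Qed.

Lemma poly_fun_section_coef j (x : homogeneous_coord (gr j)) : poly_fun (coef x).
Proof.
apply: (fa_linear (poly_fun_algebra _) (hc_fun x)).
apply: (fa_map_linear (poly_fun_algebra _) (contraction j eps)).
apply: (fa_map_app (poly_fun_algebra _)); first exact: poly_fun_id.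
apply: (fa_map_cst (poly_fun_algebra _)).
Qed.

Lemma poly_fun_num j : poly_fun (num j).
Proof.
apply: (fa_prod (poly_fun_algebra _)) => x _; exact: poly_fun_section_coef.
Qed.

Lemma poly_fun_den j : poly_fun (den j).
Proof.
apply: (fa_prod (poly_fun_algebra _)) => x _; exact: poly_fun_section_coef.
Qed.

(** Translated so that the identity becomes the origin, and with the normalisation cleared of
    denominators so that it is polynomial. *)
Let slice : set 'End(T) :=
  [set w | gr_aut grT (\1 + w)%VF /\ forall j, num j (\1 + w)%VF = den j (\1 + w)%VF].

(* The tangent space of the slice at the identity consists of the derivations
   of degree 0 on which the differentials of the normalisations vanish. *)
Lemma slice_isolated :
  exists f, [/\ poly_fun f, f 0 != 0 & forall w, slice w -> f w != 0 -> w = 0].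
Proof.
apply: isolated_origin => [|w tw].
  by split=> [|j]; rewrite addr0 ?num_id ?den_id //; apply: gr_aut_id.
apply: (Der_tensor_rigid epsE Der_neg charK0 gr_conn Der_0 (D := D)); last first.
- move=> j; pose form (x : homogeneous_coord (gr j)) := section_form eps x.
  have sumE (s : seq (homogeneous_coord (gr j))) :
      \sum_(x <- s) coef x w = \sum_(x <- s) (form x w : K).
    by apply: eq_bigr => x _; rewrite section_formE.
  have E := @tangent0_prod _ _ _ _ (ds_num (D j)) (ds_den (D j)) form w tw.
  rewrite (sumE (ds_num _)).
  rewrite (sumE (ds_den _)).
  rewrite E // => v.
  move=> [_ /(_ j)].
  have prodE (s : seq (homogeneous_coord (gr j))) :
      \prod_(x <- s) (1 + form x v) = \prod_(x <- s) coef x (\1 + v)%VF.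
    apply: eq_bigr => x _.
    by rewrite -(section_coef_id x) -!section_formE linearD.
  by rewrite !prodE.
- by apply: tangent0_gr_aut tw => z [].
Qed.

(** Moves [g] along its torus orbit until its section becomes 1, that is, into the slice. *)
Definition retraction (g : 'End(T)) : 'End(T) :=
  (g \o root_action D (std_torus_inv (section_map g)))%VF.

Lemma near_identity : exists f,
  [/\ poly_fun f, f \1%VF != 0 &
    forall g, gr_aut grT g -> f g != 0 ->
      exists2 s, std_torus s & root_action D s = g].
Proof.
have PA := poly_fun_algebra 'End(T).
have [f0 [f0P f01 f0Z]] := slice_isolated.
(* Where [Q] is nonzero, the section is defined with nonzero coordinates, so the retraction is given
   by fractions. *)
pose Q g := \prod_j (num j g * den j g).
have QP : poly_fun Q.
  apply: (fa_prod PA) => j _.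
  by apply: (fa_mul PA); [apply: poly_fun_num | apply: poly_fun_den].
pose X : set 'End(T) := [set g | Q g != 0].
have XP g : X g -> forall j, num j g != 0 /\ den j g != 0.
  by move=> /prodf_neq0 Qg j; have := Qg j isT; rewrite mulf_eq0 negb_or => /andP[].
have RA := rat_fun_algebra X.
have [p [q [pP qP fE]]] : rat_fun X (fun g => f0 (retraction g - \1)%VF).
  case: f0P => P ->; apply: fa_polyval => //; apply: fa_map_add => //.
    apply: fa_map_comp => //.
      by move=> i; apply/rat_fun_poly/poly_fun_coord.
    apply: fa_map_root_action => // j; under eq_fun do rewrite !mxE.
    apply: rat_fun_inv => [g /XP/(_ j)[n0 d0]|].
      by rewrite mulf_neq0 ?invr_eq0.
    apply: (fa_mul RA); first exact/rat_fun_poly/poly_fun_num.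
    apply: rat_fun_inv => [g /XP/(_ j)[]//|]; exact/rat_fun_poly/poly_fun_den.
  exact: fa_map_cst.
have section1 : section_map \1%VF = const_mx 1.
  by apply/rowP => j; rewrite !mxE num_id den_id divr1.
have X1 : X \1%VF.
  by apply/prodf_neq0 => j _; rewrite num_id den_id mulr1 oner_neq0.
exists (fun g => p g * Q g); split=> [||g gG]; first exact: (fa_mul PA).
  have [q1] := fE _ X1; rewrite /retraction section1.
  have -> : std_torus_inv (const_mx 1) = const_mx 1 :> 'rV[K]_r.
    by apply/rowP => j; rewrite !mxE invr1.
  rewrite root_action1 comp_lfun1l subrr => p1.
  apply: mulf_neq0 => //; apply: contraNneq f01 => p0.
  by rewrite p1 p0 mul0r.
rewrite mulf_eq0 negb_or => /andP[pg Xg].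
have s0 : std_torus (section_map g).
  by move=> j; rewrite mxE; have [n0 d0] := XP _ Xg j; rewrite mulf_neq0 ?invr_eq0.
exists (section_map g) => //.
have hE : retraction g = \1%VF.
  apply/eqP; rewrite -subr_eq0; apply/eqP/f0Z; last first.
    by have [qg ->] := fE _ Xg; rewrite mulf_neq0 ?invr_eq0.
  rewrite /slice /= addrC subrK; split=> [|j].
    by apply: gr_aut_comp => //; apply/root_action_aut/std_torus_invP.
  (* The numerator picks up one more factor [den / num] than the denominator, which makes the two
     equal. *)
  have [m []] := num_den_root_action j g (std_torus_inv (section_map g)).
  rewrite -/(retraction g) => -> ->; rewrite exprSr -mulrA; congr (_ * _).
  have [n0 d0] := XP _ Xg j; rewrite !mxE invf_div divfK //.
rewrite -[LHS]comp_lfun1l -hE /retraction -comp_lfunA -root_actionM.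
have -> : std_torus_mul (std_torus_inv (section_map g)) (section_map g) = const_mx 1.
  by apply/rowP => j; rewrite !mxE mulVf //; have := s0 j; rewrite mxE.
by rewrite root_action1 comp_lfun1r.
Qed.

End NearIdentity.

(** * Open subgroups and curves in the Zariski topology *)

Section ZariskiTopology.
Variables (K : fieldType) (W : vectType K).

(** Such a [C] is the zero locus of all polynomial functions vanishing on it, so no list of
    equations has to be chosen. *)
Lemma zariski_closed (C : set (zariski W)) :
  (forall x, (forall f : W -> K, poly_fun f -> (forall y, C y -> f y = 0) -> f x = 0) ->
     C x) -> closed C.
Proof.
move=> Cx; rewrite -openC.
exists [set p | forall y, C y -> polyval p y = 0]; apply/seteqP; split=> x /=.
  move=> nCx; apply: contrapT => H; apply: nCx; apply: Cx => _ [p ->] pC.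
  by apply/eqP; apply: contrapT => px; apply: H; exists p => //; apply/negP.
by move=> [p pC px] Cx'; rewrite pC ?eqxx in px.
Qed.

(** For invertible [g] these are the left translates of [U], written as preimages so that they are
    open by continuity. *)
Definition translates (U S : set (zariski 'End(W))) : set (zariski 'End(W)) :=
  \bigcup_(g in S) [set x | U (g^-1 \o x)%VF].

Lemma open_translates U S : open U -> open (translates U S).
Proof.
move=> oU; apply: bigcup_open => g _.
have PA := poly_fun_algebra 'End(W).
apply: (zariski_open_preimage (phi := fun x : 'End(W) => (g^-1 \o x)%VF)) => //.
by apply: fa_map_comp => //; [apply: fa_map_cst | apply: poly_fun_id].
Qed.

Section OpenSubgroup.
Variables (G T : set 'End(W)) (U : set (zariski 'End(W))).
Hypotheses (GM : forall f g, G f -> G g -> G (f \o g)%VF)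
  (GV : forall f, G f -> G (f^-1)%VF) (GL : forall f, G f -> lker f == 0%VS).
Hypotheses (TG : T `<=` G) (T1 : T \1%VF)
  (TM : forall f g, T f -> T g -> T (f \o g)%VF)
  (TV : forall f, T f -> T (f^-1)%VF).
Hypotheses (oU : open U) (U1 : U \1%VF) (GU : forall g, G g -> U g -> T g).

Let mulVK (f g : 'End(W)) : G f -> (f \o (f^-1 \o g))%VF = g.
Proof.
move=> Gf; apply/lfunP => x; rewrite !comp_lfunE lker0_lfunVK //; exact: GL.
Qed.

Let mulfV (f : 'End(W)) : G f -> (f \o f^-1)%VF = \1%VF.
Proof.
move=> Gf; apply/lfunP => x; rewrite comp_lfunE id_lfunE lker0_lfunVK //; exact: GL.
Qed.

Let mulKV (f : 'End(W)) : G f -> (f^-1 \o f)%VF = \1%VF.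
Proof.
move=> Gf; apply/lfunP => x; rewrite comp_lfunE id_lfunE lker0_lfunK //; exact: GL.
Qed.

Lemma open_subgroup : T = G `&` translates U T.
Proof.
apply/seteqP; split=> [g Tg|g [Gg [t Tt Utg]]].
  by split; [apply: TG | exists g; rewrite //= mulKV //; apply: TG].
have Gt := TG Tt; rewrite -(mulVK g Gt); apply: TM => //.
by apply: GU => //; apply: GM => //; apply: GV.
Qed.

(* The complement of an open subgroup is a union of translates of it. *)
Lemma closed_subgroup : T = G `&` ~` translates U (G `\` T).
Proof.
apply/seteqP; split=> [g Tg|g [Gg nU]].
  split=> [|[h [Gh nTh] Uhg]]; first exact: TG.
  apply: nTh; have Thg : T (h^-1 \o g)%VF.
    by apply: GU => //; apply: GM; [apply: GV | apply: TG].
  have -> : h = (g \o (h^-1 \o g)^-1)%VF.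
    rewrite -{1}(mulVK g Gh) -comp_lfunA mulfV ?comp_lfun1r //; exact: TG.
  by apply: TM => //; apply: TV.
apply: contrapT => nTg; apply: nU; exists g => //=.
by rewrite mulKV.
Qed.

Lemma connected_component_open_subgroup :
  connected_component (G : set (zariski 'End(W))) \1%VF `<=` T.
Proof.
move=> x [C [C1 CG Cc] Cx].
suff CT : C `&` T = C by move: Cx; rewrite -CT => -[].
have CGI S : C `&` (G `&` S) = C `&` S by rewrite setIA (setIidl CG).
apply: Cc; first by exists \1%VF.
  by exists (translates U T); [apply: open_translates | rewrite {1}open_subgroup CGI].
exists (~` translates U (G `\` T)); last by rewrite {1}closed_subgroup CGI.
by apply: open_closedC; apply: open_translates.
Qed.

End OpenSubgroup.

End ZariskiTopology.

Section Curves.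
Variables (K : closedFieldType) (W : vectType K).

Definition horner_fun : set (K -> K) :=
  [set f | exists p : {poly K}, f = horner p].

Lemma horner_fun_algebra : function_algebra horner_fun.
Proof.
split=> [c|_ _ [p ->] [q ->]|_ _ [p ->] [q ->]].
- by exists c%:P; apply/funext => x; rewrite hornerC.
- by exists (p + q); apply/funext => x; rewrite hornerD.
- by exists (p * q); apply/funext => x; rewrite hornerM.
Qed.

Lemma curve_connected (phi : K -> W) (q : {poly K}) : fa_map horner_fun phi ->
  connected (phi @` [set z | q.[z] != 0] : set (zariski W)).
Proof.
move=> phiP B [y By] [U oU BU] [C cC BC].
have [z qz Uz] : exists2 z, q.[z] != 0 & U (phi z).
  by move: By; rewrite BU => -[[z qz <-] Uz]; exists z.
apply: contrapT => nB.
have [_ [[z' qz' <-] nCz']] :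
    exists x, (phi @` [set z | q.[z] != 0]) x /\ ~ C x.
  apply: contrapT => H; apply: nB; rewrite BC; apply/setIidPl => x Ax.
  by apply: contrapT => nCx; apply: H; exists x.
have [f [[p ->] fz fU]] := zariski_openP oU Uz.
have [f' [[p' ->] fz' fC]] : exists f, [/\ poly_fun f, f (phi z') != 0 &
    forall x, f x != 0 -> (~` C) x].
  by apply: zariski_openP => //; rewrite openC.
have [P PE] := fa_polyval horner_fun_algebra p phiP.
have [P' P'E] := fa_polyval horner_fun_algebra p' phiP.
(* The two open conditions pull back to nonzero polynomials in the parameter; a common nonroot gives
   a point of the curve that is both in [B] and outside [C]. *)
have : P * P' * q != 0.
  have neq0 (R : {poly K}) x : R.[x] != 0 -> R != 0.
    by apply: contraNneq => ->; rewrite horner0.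
  have P0 : P != 0 by apply: (neq0 _ z); rewrite -PE.
  have P'0 : P' != 0 by apply: (neq0 _ z'); rewrite -P'E.
  by rewrite !mulf_neq0 // (neq0 _ z).
move=> /closed_nonrootP[x]; rewrite rootE !hornerM !mulf_eq0 !negb_or.
rewrite -PE -P'E => /andP[/andP[/fU Ux /fC nCx] qx].
have : B (phi x) by rewrite BU; split=> //; exists x.
by rewrite BC => -[].
Qed.

End Curves.

(** * Coordinates on row vectors *)

Section RowVectors.
Variables (K : fieldType) (r : nat).

Lemma fa_map_row (X : Type) (S : set (X -> K)) (f : 'I_r -> X -> K) :
  function_algebra S -> (forall j, S (f j)) -> fa_map S (fun x => \row_j f j x).
Proof.
move=> SA fS.
have -> : (fun x => \row_j f j x) = fun x => \sum_j f j x *: delta_mx ord0 j.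
  apply/funext => x; rewrite [LHS]row_sum_delta.
  by apply: eq_bigr => j _; rewrite mxE.
by apply: fa_map_lincomb => // j; apply: fa_map_cst.
Qed.

(** Polynomial functions refer to the basis [vbasis], not to the standard one, so an entry is first
    a linear combination of coordinates. *)
Lemma poly_fun_entry j : poly_fun (fun t : 'rV[K]_r => t ord0 j).
Proof.
have -> : (fun t : 'rV[K]_r => t ord0 j) = fun t =>
    \sum_i coord (vbasis {:'rV[K]_r}) i t * (vbasis {:'rV[K]_r})`_i ord0 j.
  apply/funext => t; rewrite {1}(coord_vbasis (memvf t)) summxE.
  by apply: eq_bigr => i _; rewrite mxE.
apply: (fa_sum (poly_fun_algebra _)) => i _.
apply: (fa_mul (poly_fun_algebra _)); first exact: poly_fun_coord.
exact: (fa_cst (poly_fun_algebra _)).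
Qed.

Lemma finite_rV (s : seq K) :
  finite_set [set t : 'rV[K]_r | forall j, t ord0 j \in s].
Proof.
pose f (u : {ffun 'I_r -> seq_sub s}) : 'rV[K]_r := \row_j val (u j).
apply: (@sub_finite_set _ _ (f @` setT)) => [t ts|].
  exists [ffun j => SeqSub (ts j)] => //.
  by apply/rowP => j; rewrite mxE ffunE.
by apply: finite_image; apply: finite_finset.
Qed.

End RowVectors.

(** * Closedness of the group of graded automorphisms; augmentations *)

Section GradedAutomorphismsClosed.
Variables (K : fieldType) (A : falgType K) (gr : grading A).

Lemma fa_map_algmul (X : Type) (S : set (X -> K)) (phi psi : X -> A) :
  function_algebra S -> fa_map S phi -> fa_map S psi ->
  fa_map S (fun x => phi x * psi x).
Proof.
move=> SA phiS psiS i.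
have [n [c [m mE]]] := functional_mul (coord (vbasis {:A}) i : {linear A -> K^o}).
under eq_fun do rewrite mE.
by apply: (fa_sum SA) => k _; apply: (fa_mul SA); apply: (fa_linear SA).
Qed.

Lemma gr_aut_closed : exists2 C : set (zariski 'End(A)),
  closed C & gr_aut gr = C `&` @lin_group K A.
Proof.
pose C : set (zariski 'End(A)) := [set g : 'End(A) | [/\ g 1 = 1,
  forall a b, g (a * b) = g a * g b & forall q x, x \in gr q -> g x \in gr q]].
exists C; last first.
  apply/seteqP; split=> [g /gr_autP[gi g1 gM gq]|g [[g1 gM gq] gi]]; first by split.
  exact/gr_autP.
have PA := poly_fun_algebra 'End(A).
have evP a : fa_map (@poly_fun _ 'End(A)) (fun g => g a).
  by apply: fa_map_app => //; [apply: poly_fun_id | apply: fa_map_cst].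
apply: zariski_closed => x xC.
(* Vector-valued equations are tested against functionals; each condition defining [C] is then such
   an equation. *)
have eq0 (f : 'End(A) -> A) : fa_map (@poly_fun _ 'End(A)) f ->
    (forall y : 'End(A), C y -> f y = 0) -> f x = 0.
  move=> fP fC; apply: functionals_eq0 => l; apply: (xC (fun y => l (f y))).
    exact: fa_linear.
  by move=> y /fC ->; rewrite linear0.
split=> [|a b|q y yq].
- apply/eqP; rewrite -subr_eq0; apply/eqP.
  apply: (eq0 (fun g => g 1 - 1)) => [|y [-> _ _]]; last by rewrite subrr.
  by apply: fa_map_add => //; apply: fa_map_cst.
- apply/eqP; rewrite -subr_eq0; apply/eqP.
  apply: (eq0 (fun g => g (a * b) - g a * g b)) => [|y [_ -> _]]; last by rewrite subrr.
  under [X in fa_map _ X]eq_fun do rewrite -mulN1r.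
  apply: fa_map_add => //; apply: fa_map_algmul => //; first exact: fa_map_cst.
  exact: fa_map_algmul.
- have -> : x y = gr_proj gr q (x y); last exact: gr_proj_mem.
  apply/eqP; rewrite -subr_eq0; apply/eqP.
  pose p := (\1 - gr_proj gr q)%VF.
  suff : p (x y) = 0 by rewrite add_lfunE id_lfunE opp_lfunE.
  apply: (eq0 (fun g => p (g y))) => [|g [_ _ /(_ q y yq) gyq]].
    exact: (fa_map_linear PA p).
  by rewrite add_lfunE id_lfunE opp_lfunE (gr_projE _ gyq) eqxx subrr.
Qed.

Lemma augmentation_exists : gr_connected gr ->
  exists eps : 'Hom(A, K^o), forall x, gr_proj gr 0 x = (eps x : K) *: 1.
Proof.
move=> conn; have [f f1] := functional_neq0 (oner_neq0 A).
exists (f \o gr_proj gr 0)%VF => x; rewrite comp_lfunE.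
have := gr_proj_mem gr 0 x; rewrite conn => /vlineP[k ->].
by rewrite linearZ /= f1; congr (_ *: _); rewrite [RHS]mulr1.
Qed.

End GradedAutomorphismsClosed.

(** * The torus image lies in the identity component *)

Section ImageOfTorus.
Variables (K : closedFieldType) (r : nat) (B : 'I_r -> comFalgType K).
Variable gr : forall j, grading (B j).
Local Notation grT := (tensor_grading gr).

Lemma torus_action_component t : std_torus t ->
  gr_aut1 grT (torus_action gr t).
Proof.
(* The line passes through the identity at 0 and through [t] at 1; [q] vanishes exactly where it
   leaves the torus. *)
move=> t0; pose line (z : K) : 'rV[K]_r := \row_j (1 + (t ord0 j - 1) * z).
pose q : {poly K} := \prod_j (1 + (t ord0 j - 1)%:P * 'X).
have qE z : q.[z] = \prod_j line z ord0 j.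
  by rewrite horner_prod; apply: eq_bigr => j _; rewrite !hornerE mxE.
have line1 : line 1 = t by apply/rowP => j; rewrite mxE mulr1 addrC subrK.
have line0 : line 0 = const_mx 1 by apply/rowP => j; rewrite !mxE mulr0 addr0.
have std z : q.[z] != 0 -> std_torus (line z).
  by rewrite qE => /prodf_neq0 H j; apply: H.
have HA := horner_fun_algebra K.
exists ((torus_action gr \o line) @` [set z | q.[z] != 0]); last first.
  exists 1 => /=; last by rewrite line1.
  by rewrite qE line1; apply/prodf_neq0 => j _; apply: t0.
split.
- exists 0; last by rewrite /= line0 torus_action1.
  by rewrite /= qE line0; apply/prodf_neq0 => j _; rewrite mxE oner_neq0.
- by move=> _ [z qz <-]; apply/torus_action_aut/std.
- apply: curve_connected; apply: fa_map_torus_action => // j.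
  under eq_fun do rewrite mxE.
  exists (1 + (t ord0 j - 1)%:P * 'X); apply/funext => z.
  by rewrite !hornerE.
Qed.

End ImageOfTorus.

(** * Surjectivity, finite kernel and torus structure *)

Theorem corollary2p6 (K : closedFieldType) (charK0 : [pchar K] =i pred0)
    (r : nat) (B : 'I_r -> comFalgType K) (gr : forall j, grading (B j))
    (gr_conn : forall j, gr_connected (gr j))
    (gr_ev : forall j, gr_even (gr j))
    (Der_neg : forall j (p : int), p < 0 -> Der (gr j) p = [set 0])
    (Der_0 : forall j, set_dim (Der (gr j) 0) 1) :
  [/\ torus_morphism (gr_aut1 (tensor_grading gr)) (torus_action gr),
      torus_action gr @` @std_torus K r = gr_aut1 (tensor_grading gr),
      finite_set [set t | std_torus t /\ torus_action gr t = \1%VF]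
    & is_torus r (gr_aut1 (tensor_grading gr))].
Proof.
pose D j := projT1 (cid (degree_section_exists charK0 (gr_conn j) (Der_0 j))).
pose eps j := projT1 (cid (augmentation_exists (gr_conn j))).
have epsE i x : gr_proj (gr i) 0 x = (eps i x : K) *: 1.
  exact: projT2 (cid (augmentation_exists (gr_conn i))) x.
set G := gr_aut (tensor_grading gr).
have GL f : G f -> lker f == 0%VS by case.
have [f [[p fE] f1 fG]] := near_identity charK0 gr_conn Der_neg Der_0 D epsE.
pose U : set (zariski 'End(tensor B)) := [set g | f g != 0].
have oU : open U by apply: poly_fun_open; exists p.
pose T : set 'End(tensor B) := torus_action gr @` @std_torus K r.
have TE : root_action D @` @std_torus K r = T := root_action_image D.
have GU g : G g -> U g -> T g.
  by move=> Gg Ug; rewrite -TE; have [s s0 <-] := fG g Gg Ug; exists s.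
have TG : T `<=` G by move=> _ [t t0 <-]; apply: torus_action_aut.
have std1 : std_torus (const_mx 1 : 'rV[K]_r) by move=> j; rewrite mxE oner_neq0.
have T1 : T \1%VF by exists (const_mx 1) => //; apply: torus_action1.
have TM g h : T g -> T h -> T (g \o h)%VF.
  move=> [s s0 <-] [t t0 <-]; exists (std_torus_mul s t); last exact: torus_actionM.
  by move=> j; rewrite mxE mulf_neq0 ?s0 ?t0.
have TV g : T g -> T (g^-1)%VF.
  move=> [t t0 <-]; rewrite torus_action_inv //; exists (std_torus_inv t) => //.
  exact: std_torus_invP.
have GM := @gr_aut_comp _ _ (tensor_grading gr).
have GV := @gr_aut_inv _ _ (tensor_grading gr).
have T_component : T = gr_aut1 (tensor_grading gr).
  apply/seteqP; split=> [_ [t t0 <-]|]; first exact: torus_action_component.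
  exact: (connected_component_open_subgroup GM GV GL TG T1 TM TV oU f1 GU).
rewrite -T_component.
have PA := poly_fun_algebra 'rV[K]_r.
have T_morphism phi : fa_map (@poly_fun _ 'rV[K]_r) phi ->
    (forall t, std_torus t -> T (phi t)) ->
    (forall s t, phi (std_torus_mul s t) = (phi s \o phi t)%VF) ->
    torus_morphism T phi.
  move=> phiP phiT phiM; split=> [|s t _ _]; last exact: phiM.
  by split=> // i; apply/rat_fun_regular/rat_fun_poly/phiP.
have rootK s : std_torus s -> section_map D eps (root_action D s) = s.
  exact: section_map_root_action.
split.
- apply: T_morphism => [|t t0|s t]; last exact: torus_actionM.
    by apply: fa_map_torus_action => // j; apply: poly_fun_entry.
  by exists t.
- by [].
(* If [t] acts trivially, so does the point with coordinates [t ord0 j ^+ ds_gcd (D j)] under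
   [root_action]. The section recovers that point, so it is 1 and the coordinates of [t] are roots
   of unity of bounded order. *)
- have rootsP j : exists s : seq K, forall c, c ^+ ds_gcd (D j) = 1 -> c \in s.
    have := closed_field_poly_normal ('X^(ds_gcd (D j)) - 1%:P : {poly K}).
    move=> [s sE]; exists s => c c1.
    have : root ('X^(ds_gcd (D j)) - 1%:P : {poly K}) c.
      by rewrite rootE !hornerE c1 subrr.
    rewrite sE rootZ ?lead_coef_eq0 -?size_poly_eq0 ?size_XnsubC ?ds_gcd_gt0 //.
    by rewrite root_prod_XsubC.
  have /choice[s sP] := rootsP.
  apply: sub_finite_set (finite_rV r (flatten [seq s j | j <- enum 'I_r])).
  move=> t [t0 tE] j; apply/flattenP; exists (s j).
    by apply/mapP; exists j; rewrite ?mem_enum.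
  apply: sP; pose u : 'rV[K]_r := \row_j t ord0 j ^+ ds_gcd (D j).
  have tu i : t ord0 i ^+ ds_gcd (D i) = u ord0 i by rewrite mxE.
  have := rootK u ((torus_root_std tu).2 t0).
  rewrite (root_actionE tu) tE -(root_action1 D) rootK // => /rowP/(_ j).
  by rewrite !mxE => <-.
- split.
    have [C cC GE] := gr_aut_closed (tensor_grading gr).
    (* The closed equations of [G] are intersected with the complement of the translates of [U] by
       elements outside [T]. *)
    split=> //; exists (C `&` ~` translates U (G `\` T)).
      by apply: closedI => //; apply/open_closedC/open_translates.
    rewrite {1}(closed_subgroup GM GV GL TG TM TV f1 GU) /G GE.
    by rewrite setIAC.
  (* [torus_action] can have a nontrivial kernel; its effective quotient [root_action] is the
     isomorphism, with the rational section as inverse. *)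
  exists (root_action D), (section_map D eps); split=> //.
  + apply: T_morphism => [|t t0|s t]; last exact: root_actionM.
      by apply: fa_map_root_action => // j; apply: poly_fun_entry.
    by rewrite -TE; exists t.
  + split=> [g|i]; first by rewrite -TE => -[s s0 <-]; rewrite rootK.
    apply: rat_fun_regular; apply: fa_map_row => [|j]; first exact: rat_fun_algebra.
    apply: (fa_mul (rat_fun_algebra _)); first exact/rat_fun_poly/poly_fun_num.
    apply: rat_fun_inv; last exact/rat_fun_poly/poly_fun_den.
    by move=> g; rewrite -TE => -[s s0 <-]; apply: den_root_action.
  + by move=> g; rewrite -TE => -[s s0 <-]; rewrite rootK.
Qed.
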